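(* For $j=1,2,3,4$ let $\mu_j\ne\nu_j$ be nonzero complex numbers with $\prod_{j=1}^4\mu_j\nu_j=1$ and $\sigma_1\sigma_2\sigma_3\sigma_4\ne1$ for every choice of $\sigma_j\in\{\mu_j,\nu_j\}$. Let $C_j\subset GL(4,{\bf C})$ be the conjugacy class of diagonalizable matrices with eigenvalues $\mu_j,\nu_j$, each of multiplicity $2$. Let ${\cal N}$ be the variety of quadruples $(M_1,\ldots,M_4)$, $M_j\in C_j$, $M_1M_2M_3M_4=I$, which are simultaneously conjugate to a quadruple of the form $$M_j=\left(\begin{array}{cc}B_j&0\\0&G_j\end{array}\right),\qquad j=1,\ldots,4,$$ where $B_j,G_j\in GL(2,{\bf C})$ are diagonalizable with eigenvalues $\mu_j,\nu_j$, $B_1B_2B_3B_4=G_1G_2G_3G_4=I$, and the quadruples $(B_j)$ and $(G_j)$ define non-equivalent representations. Then $\dim{\cal N}=18$, whereas the expected dimension $\sum_{j=1}^4\dim C_j-4^2+1$ equals $17$.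
   Context: Two quadruples $(B_j)$, $(G_j)$ of $2\times2$ matrices define equivalent representations if they are simultaneously conjugate by a matrix from $GL(2,{\bf C})$. The condition $\sigma_1\sigma_2\sigma_3\sigma_4\neq1$ says that the eigenvalues of the $2\times2$ quadruples are generic, so all such quadruples $(B_j)$, $(G_j)$ are irreducible. Dimensions are complex dimensions. *)

(* Defs.v *)
From HB Require Import structures.
From mathcomp Require Import all_boot all_order all_algebra.
From mathcomp Require Import classical_sets reals.
From mathcomp Require Import mpoly complex.

Set Implicit Arguments.
Unset Strict Implicit.
Unset Printing Implicit Defensive.

Import GRing.Theory.

Local Open Scope classical_set_scope.
Local Open Scope ring_scope.

(* The Zariski topology of a finite-dimensional vector space, written in the
   coordinates of the library's basis of V. A linear change of coordinates
   maps polynomials to polynomials, so the topology does not depend on this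
   basis. *)
Section Zariski.
Variables (K : fieldType) (V : vectType K).

Definition poly_eval (p : {mpoly K[\dim {:V}]}) (v : V) : K :=
  p.@[fun i => coord (vbasis {:V}) i v].

Definition zeros (I : set {mpoly K[\dim {:V}]}) : set V :=
  [set v | forall p, I p -> poly_eval p v = 0].

Definition zclosed_in (S Z : set V) : Prop := exists I, Z = S `&` zeros I.

Definition zirreducible (Z : set V) : Prop :=
  Z !=set0 /\
  forall Y1 Y2, zclosed_in Z Y1 -> zclosed_in Z Y2 -> Z = Y1 `|` Y2 ->
    Z = Y1 \/ Z = Y2.

(* A chain Z 0 < ... < Z d of length d; the values Z k for k > d are junk. *)
Definition zchain (S : set V) (d : nat) (Z : nat -> set V) : Prop :=
  (forall k, (k <= d)%N -> zclosed_in S (Z k) /\ zirreducible (Z k)) /\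
  (forall k, (k < d)%N -> Z k `<` Z k.+1).

(* S has dimension d: the Krull dimension of S with its induced topology.
   S is not required to be closed; for a constructible S this is also the
   dimension of its Zariski closure. *)
Definition has_dim (S : set V) (d : nat) : Prop :=
  (exists Z, zchain S d Z) /\ (forall e Z, zchain S e Z -> (e <= d)%N).

End Zariski.

Section Quadruples.
Variable K : fieldType.

(* A is an invertible diagonalizable matrix whose eigenvalues, listed with
   multiplicity, are those of s. *)
Definition diag_with n (s : seq K) (A : 'M[K]_n) : Prop :=
  [/\ A \in unitmx, diagonalizable A
    & char_poly A = \prod_(a <- s) ('X - a%:P)].

Definition sim_conj n (A B : 'I_4 -> 'M[K]_n) : Prop :=
  exists2 P : 'M[K]_n, P \in unitmx & forall j, B j = invmx P *m A j *m P.

Definition conj_class (mu nu : K) : set 'M[K]_4 :=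
  [set A | diag_with [:: mu; mu; nu; nu] A].

Definition block_quadruple (B G : 'I_4 -> 'M[K]_2) (j : 'I_4) : 'M[K]_4 :=
  block_mx (B j) 0 0 (G j) : 'M[K]_(2 + 2).

Definition varN (mu nu : 'I_4 -> K) : set {ffun 'I_4 -> 'M[K]_4} :=
  [set M |
    [/\ forall j, conj_class (mu j) (nu j) (M j),
        \prod_(j < 4) M j = 1
      & exists B G : 'I_4 -> 'M[K]_2,
        [/\ sim_conj (block_quadruple B G) M,
            forall j, diag_with [:: mu j; nu j] (B j)
                   /\ diag_with [:: mu j; nu j] (G j),
            \prod_(j < 4) B j = 1,
            \prod_(j < 4) G j = 1
          & ~ sim_conj B G]]].

End Quadruples.

(* Main.v *)
Require Import Defs.
From HB Require Import structures.
From mathcomp Require Import all_boot all_order all_algebra all_fingroup.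
From mathcomp Require Import classical_sets reals boolp.
From mathcomp Require Import mpoly complex.
From mathcomp Require Import ring.

(* Upper bounds. If a subset S of affine space contains a chain of e + 1 irreducible
   closed subsets, then its Hilbert function grows at least like D ^ e: when g vanishes
   on a subset Z but not on an irreducible Z' containing it, the powers of g are linearly
   independent over any family of functions that is independent on Z.
   On the other side, every quadruple in N is conj_Q (B, G) for a matrix Q normalized on
   two pairs of columns (8 parameters), where B and G are two quadruples of 2 x 2
   matrices. For fixed C = B 0 *m B 1 the matrix B 2 runs over a conic, so the
   coordinates of B are quadratic over 5 parameters. Hence the Hilbert function
   of N is O(D ^ (8 + 5 + 5)), and that of a conjugacy class is O(D ^ 8).

   Lower bounds. A set in which any two points are joined by a rational curve has an
   irreducible closure, which provides a chain of closures of images of linear spaces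
   of parameters. The steps along the orbit of a quadruple are strict because "there is a
   nonzero Q in a given linear space with Q *m M j = M0 j *m Q" is a determinantal
   condition on M, and the four remaining ones are separated by conjugation invariants. *)

Set Implicit Arguments.
Unset Strict Implicit.
Unset Printing Implicit Defensive.

Import GRing.Theory.

Local Open Scope ring_scope.

(** * Rings of functions and the Zariski topology *)

(** The expected dimension presupposes that only scalars commute with a quadruple. Two
    non-equivalent irreducible blocks have a centralizer of dimension 2, so the orbit has dimension
    16 - 2 = 14; two moduli for each block give 14 + 2 + 2 = 18, one more than expected. The chain
    of length 18 follows this count, and the upper bound regroups it as 8 + 5 + 5. The definition of
    N contains an existential and a negation, so N is not presented by equations. Both bounds
    therefore work with images and coverings instead of ideals. In the upper bound, pivots and
    denominators change from piece to piece; this is harmless because finite unions, inverses and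
    roots of quadratic equations change only the constant of a Hilbert function, while each free
    parameter raises its exponent by one. In the lower bound, conjugation can exchange the two
    blocks, so the trace of a single block is not a function on N. Hence the moduli of the second
    block are detected by a determinant that is symmetric in the blocks. *)

Section FunctionRings.
Local Open Scope classical_set_scope.
Variables (K : comNzRingType) (X : Type).

(** The instances are regular functions, [alg T F], [polyfun] and [ratfun U]; determinants,
    adjugates and matrix products are treated once for all four. *)
Record funring (A : set (X -> K)) : Prop := FunRing {
  funring_cst : forall c, A (fun=> c);
  funring_add : forall f g, A f -> A g -> A (fun x => f x + g x);
  funring_mul : forall f g, A f -> A g -> A (fun x => f x * g x) }.

Variable A : set (X -> K).
Hypothesis HA : funring A.

Lemma funring_ext f g : A f -> f =1 g -> A g.
Proof. by move=> Af fg; rewrite -(funext fg). Qed.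

Lemma funring_opp f : A f -> A (fun x => - f x).
Proof.
move=> Af; apply: funring_ext (funring_mul HA (funring_cst HA (-1)) Af) _.
by move=> x /=; rewrite mulN1r.
Qed.

Lemma funring_sub f g : A f -> A g -> A (fun x => f x - g x).
Proof. by move=> Af Ag; exact: (funring_add HA Af (funring_opp Ag)). Qed.

Lemma funring_sum (I : Type) (r : seq I) (P : pred I) (F : I -> X -> K) :
  (forall i, P i -> A (F i)) -> A (fun x => \sum_(i <- r | P i) F i x).
Proof.
move=> AF; elim: r => [|i r IH].
  by apply: funring_ext (funring_cst HA 0) _ => x; rewrite big_nil.
have [Pi|nPi] := boolP (P i); last first.
  by apply: funring_ext IH _ => x; rewrite big_cons (negbTE nPi).
by apply: funring_ext (funring_add HA (AF i Pi) IH) _ => x; rewrite big_cons Pi.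
Qed.

Lemma funring_prod (I : Type) (r : seq I) (P : pred I) (F : I -> X -> K) :
  (forall i, P i -> A (F i)) -> A (fun x => \prod_(i <- r | P i) F i x).
Proof.
move=> AF; elim: r => [|i r IH].
  by apply: funring_ext (funring_cst HA 1) _ => x; rewrite big_nil.
have [Pi|nPi] := boolP (P i); last first.
  by apply: funring_ext IH _ => x; rewrite big_cons (negbTE nPi).
by apply: funring_ext (funring_mul HA (AF i Pi) IH) _ => x; rewrite big_cons Pi.
Qed.

Lemma funring_exp f n : A f -> A (fun x => f x ^+ n).
Proof.
move=> Af; elim: n => [|n IH]; first exact: funring_cst.
by apply: funring_ext (funring_mul HA Af IH) _ => x; rewrite exprS.
Qed.

Definition mx_in m n (M : X -> 'M[K]_(m, n)) := forall i j, A (fun x => M x i j).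

Lemma mx_in_cst m n (M : 'M[K]_(m, n)) : mx_in (fun=> M).
Proof. by move=> i j; exact: funring_cst. Qed.

Lemma mx_in_add m n (M N : X -> 'M[K]_(m, n)) :
  mx_in M -> mx_in N -> mx_in (fun x => M x + N x).
Proof.
move=> AM AN i j; apply: funring_ext (funring_add HA (AM i j) (AN i j)) _ => x.
by rewrite mxE.
Qed.

Lemma mx_in_scale m n (f : X -> K) (M : X -> 'M[K]_(m, n)) :
  A f -> mx_in M -> mx_in (fun x => f x *: M x).
Proof.
move=> Af AM i j; apply: funring_ext (funring_mul HA Af (AM i j)) _ => x.
by rewrite mxE.
Qed.

Lemma mx_in_mul m n p (M : X -> 'M[K]_(m, n)) (N : X -> 'M[K]_(n, p)) :
  mx_in M -> mx_in N -> mx_in (fun x => M x *m N x).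
Proof.
move=> AM AN i j.
have /funring_ext : A (fun x => \sum_k M x i k * N x k j).
  by apply: funring_sum => k _; exact: funring_mul.
by apply=> x; rewrite mxE.
Qed.

Lemma funring_det n (M : X -> 'M[K]_n) : mx_in M -> A (fun x => \det (M x)).
Proof.
move=> AM; apply: funring_sum => s _; apply: funring_mul => //.
  exact: funring_cst.
by apply: funring_prod => i _; exact: AM.
Qed.

Lemma funring_trace n (M : X -> 'M[K]_n) : mx_in M -> A (fun x => \tr (M x)).
Proof. by move=> AM; apply: funring_sum => i _; exact: AM. Qed.

Lemma mx_in_adj n (M : X -> 'M[K]_n) : mx_in M -> mx_in (fun x => \adj (M x)).
Proof.
move=> AM i j.
have /funring_ext : A (fun x => cofactor (M x) j i).
  apply: funring_mul => //; first exact: funring_cst.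
  apply: funring_det => k l.
  by have /funring_ext := AM (lift j k) (lift i l); apply=> x; rewrite !mxE.
by apply=> x; rewrite mxE.
Qed.

Lemma mx_in_block m1 m2 n1 n2 (M : X -> 'M[K]_(m1, n1)) (N : X -> 'M[K]_(m1, n2))
    (P : X -> 'M[K]_(m2, n1)) (Q : X -> 'M[K]_(m2, n2)) :
  mx_in M -> mx_in N -> mx_in P -> mx_in Q ->
  mx_in (fun x => block_mx (M x) (N x) (P x) (Q x)).
Proof.
move=> AM AN AP AQ i j; case: (split_ordP i) => k ->; case: (split_ordP j) => l ->.
- by have /funring_ext := AM k l; apply=> x; rewrite block_mxEul.
- by have /funring_ext := AN k l; apply=> x; rewrite block_mxEur.
- by have /funring_ext := AP k l; apply=> x; rewrite block_mxEdl.
- by have /funring_ext := AQ k l; apply=> x; rewrite block_mxEdr.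
Qed.

End FunctionRings.

(** * Entries of 2 x 2 matrices and indices below four *)

Section TwoByTwo.
Local Open Scope classical_set_scope.
Variable R : comNzRingType.

Lemma mx2_det (A : 'M[R]_2) : \det A = A 0 0 * A 1 1 - A 0 1 * A 1 0.
Proof.
rewrite (expand_det_row _ 0) !big_ord_recl big_ord0 addr0 /cofactor !det_mx11.
rewrite !mxE /= expr0 mul1r expr1 mulN1r mulrN.
by congr (A _ _ * A _ _ - A _ _ * A _ _); apply/val_inj.
Qed.

Lemma mx2_trace (A : 'M[R]_2) : \tr A = A 0 0 + A 1 1.
Proof.
rewrite /mxtrace !big_ord_recl big_ord0 addr0.
by congr (A _ _ + A _ _); apply/val_inj.
Qed.

Lemma mx2_mulE (A B : 'M[R]_2) i j : (A *m B) i j = A i 0 * B 0 j + A i 1 * B 1 j.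
Proof.
rewrite mxE !big_ord_recl big_ord0 addr0.
by congr (A _ _ * B _ _ + A _ _ * B _ _); apply/val_inj.
Qed.

Lemma ord2P (P : 'I_2 -> Prop) : P 0 -> P 1 -> forall i, P i.
Proof.
move=> P0 P1 [[|[|//]] lti]; first by rewrite (_ : Ordinal lti = 0)//; exact/val_inj.
by rewrite (_ : Ordinal lti = 1)//; exact/val_inj.
Qed.

End TwoByTwo.

Definition i2 : 'I_4 := Ordinal (isT : 2 < 4)%N.
Definition i3 : 'I_4 := Ordinal (isT : 3 < 4)%N.

Lemma ord4P (P : 'I_4 -> Prop) : P 0 -> P 1 -> P i2 -> P i3 -> forall i, P i.
Proof.
move=> P0 P1 P2 P3 [[|[|[|[|//]]]] lti].
- by rewrite (_ : Ordinal lti = 0)//; exact/val_inj.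
- by rewrite (_ : Ordinal lti = 1)//; exact/val_inj.
- by rewrite (_ : Ordinal lti = i2)//; exact/val_inj.
- by rewrite (_ : Ordinal lti = i3)//; exact/val_inj.
Qed.

Lemma prod_ord4 (R : pzRingType) (F : 'I_4 -> R) :
  \prod_(j < 4) F j = F 0 * F 1 * F i2 * F i3.
Proof.
rewrite !big_ord_recl big_ord0 mulr1 !mulrA.
by congr (F _ * F _ * F _ * F _); exact/val_inj.
Qed.

Section InverseMatrices.
Local Open Scope classical_set_scope.
Variables (K : fieldType) (X : Type) (T : set X) (A : set (X -> K)).
Hypotheses (HA : funring A)
  (Aon : forall f g, A f -> (forall x, T x -> f x = g x) -> A g).

(** On [T] the inverse is [(\det M)^-1 *: \adj M]. The identity may fail off [T], whence the
    hypothesis that membership in [A] depends only on values on [T]. *)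
Lemma mx_in_right_inverse n (M N : X -> 'M[K]_n) :
  (forall x, T x -> M x *m N x = 1%:M) -> A (fun x => (\det (M x))^-1) ->
  mx_in A M -> mx_in A N.
Proof.
move=> MN Ad AM i j; apply: Aon (mx_in_scale HA Ad (mx_in_adj HA AM) i j) _ => x Tx.
have [uM _] := mulmx1_unit (MN x Tx).
by rewrite -[in RHS](mul1mx (N x)) -(mulVmx uM) -mulmxA MN// mulmx1 /invmx uM.
Qed.

End InverseMatrices.

(** * Regular functions, prime ideals and irreducible closures *)

Section ZariskiTopology.
Local Open Scope classical_set_scope.
Variables (K : fieldType) (V : vectType K).
Implicit Types (S Y Z : set V) (p q : {mpoly K[\dim {:V}]}).

Lemma poly_evalD p q v : poly_eval (p + q) v = poly_eval p v + poly_eval q v.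
Proof. exact: mevalD. Qed.

Lemma poly_evalM p q v : poly_eval (p * q) v = poly_eval p v * poly_eval q v.
Proof. exact: mevalM. Qed.

Lemma poly_evalC c v : @poly_eval K V c%:MP v = c.
Proof. exact: mevalC. Qed.

Definition regular (f : V -> K) := exists p, forall v, poly_eval p v = f v.

Lemma regular_poly p : regular (poly_eval p).
Proof. by exists p. Qed.

Lemma regular_funring : funring regular.
Proof.
split=> [c|f g [p pf] [q qg]|f g [p pf] [q qg]].
- by exists c%:MP => v; rewrite poly_evalC.
- by exists (p + q) => v; rewrite poly_evalD pf qg.
- by exists (p * q) => v; rewrite poly_evalM pf qg.
Qed.

Lemma regular_coord i : regular (coord (vbasis {:V}) i).
Proof. by exists 'X_i => v; rewrite /poly_eval mevalXU. Qed.

Lemma regular_scalar (f : {scalar V}) : regular f.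
Proof.
have /funring_ext : regular (fun v =>
    \sum_i coord (vbasis {:V}) i v * f (vbasis {:V})`_i).
  apply: (funring_sum regular_funring) => i _.
  apply: (funring_mul regular_funring); first exact: regular_coord.
  exact: (funring_cst regular_funring).
apply=> v; rewrite {2}(coord_vbasis (memvf v)) linear_sum.
by apply: eq_bigr => i _; rewrite linearZ.
Qed.

Lemma regular_comp (X : Type) (A : set (X -> K)) (phi : X -> V) f :
  funring A -> (forall i, A (fun x => coord (vbasis {:V}) i (phi x))) ->
  regular f -> A (fun x => f (phi x)).
Proof.
move=> HA Aphi [p pf].
have /funring_ext : A (fun x =>
    \sum_(m <- msupp p) p@_m * \prod_i coord (vbasis {:V}) i (phi x) ^+ m i).
  apply: (funring_sum HA) => m _; apply: (funring_mul HA).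
    exact: (funring_cst HA).
  by apply: (funring_prod HA) => i _; exact: (funring_exp HA).
by apply=> x; rewrite -pf /poly_eval mevalE.
Qed.

(** The functions vanishing on [Y] form a prime ideal, or the whole ring if [Y] is empty. This can
    be proved on an image that is not closed and then passed to its closure. *)
Definition integral_on Y := forall f g, regular f -> regular g ->
  (forall v, Y v -> f v * g v = 0) ->
  (forall v, Y v -> f v = 0) \/ (forall v, Y v -> g v = 0).

Lemma zirreducible_integral Z : zirreducible Z -> integral_on Z.
Proof.
move=> [_ irrZ] f g [p pf] [q qg] fg0.
pose Y1 := Z `&` zeros [set p]; pose Y2 := Z `&` zeros [set q].
have [|||ZY1|ZY2] := irrZ Y1 Y2; [by eexists|by eexists| | |].
- apply/seteqP; split=> v; last by case=> [[]|[]].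
  move=> Zv; have /eqP := fg0 v Zv; rewrite mulf_eq0 => /orP[]/eqP fv0.
    by left; split=> // _ ->; rewrite pf.
  by right; split=> // _ ->; rewrite qg.
- by left=> v; rewrite ZY1 => -[_ /(_ p erefl)]; rewrite pf.
- by right=> v; rewrite ZY2 => -[_ /(_ q erefl)]; rewrite qg.
Qed.

Definition zclosure S Y := S `&` zeros [set p | forall v, Y v -> poly_eval p v = 0].

Lemma sub_zclosure S Y : Y `<=` S -> Y `<=` zclosure S Y.
Proof. by move=> YS v Yv; split; [exact: YS|move=> p; apply]. Qed.

(** If an equation [p] of [Y1] fails somewhere on the closure, it fails somewhere on [Y]. For each
    equation [q] of [Y2] the product [p * q] vanishes on [Y], so [q] vanishes on [Y] and hence on
    the closure. *)
Lemma zclosure_irreducible S Y :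
  Y `<=` S -> Y !=set0 -> integral_on Y -> zirreducible (zclosure S Y).
Proof.
move=> YS [y Yy] intY; split; first by exists y; exact: sub_zclosure.
move=> Y1 Y2 [I1 defY1] [I2 defY2] defZ.
have [sub1|/existsNP[p /not_implyP[I1p /existsNP[v /not_implyP[Zv pv]]]]] :=
  pselect (forall p, I1 p -> forall v, zclosure S Y v -> poly_eval p v = 0).
  left; rewrite defY1; apply/seteqP; split=> [v Zv|v []//].
  by split=> // p I1p; exact: sub1.
right; rewrite defY2; apply/seteqP; split=> [w Zw|w []//].
split=> // q I2q; have [|pY|qY] := intY _ _ (regular_poly p) (regular_poly q).
- move=> u Yu; have : (Y1 `|` Y2) u by rewrite -defZ; exact: sub_zclosure.
  rewrite defY1 defY2 => -[[_ /(_ p I1p)->]|[_ /(_ q I2q)->]].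
    by rewrite mul0r.
  by rewrite mulr0.
- by case: pv; apply: Zv.2.
- by apply: Zw.2.
Qed.

(** A regular [h] that vanishes on [Y k] vanishes on its closure, so one point of [Y k.+1] with
    [h v <> 0] makes the inclusion of closures strict. *)
Lemma zchain_of_images S d (Y : nat -> set V) :
  (forall k, (k <= d)%N -> [/\ Y k `<=` S, Y k !=set0 & integral_on (Y k)]) ->
  (forall k, (k < d)%N -> Y k `<=` Y k.+1 /\
     exists2 h, regular h &
       (forall v, Y k v -> h v = 0) /\ exists2 v, Y k.+1 v & h v <> 0) ->
  exists W, zchain S d W.
Proof.
move=> HY Hstep; exists (fun k => zclosure S (Y k)); split=> k le_kd.
  have [YS Y0 intY] := HY k le_kd; split; first by eexists.
  exact: zclosure_irreducible.
have [Ysub [h [p ph] [h0 [v Yv hv]]]] := Hstep k le_kd.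
have [YS _ _] := HY _ le_kd; split=> [w [Sw Zw]|/(_ v)].
  by split=> // q q0; apply: Zw => u Yu; apply: q0; exact: Ysub.
case/(_ (sub_zclosure YS Yv)) => _ /(_ p) pv; apply: hv; rewrite -ph; apply: pv.
by move=> u Yu; rewrite ph; exact: h0.
Qed.

End ZariskiTopology.

(** * Hilbert functions and the upper bounds *)

Section Growth.
Local Open Scope classical_set_scope.
Variables (K : fieldType) (X : Type).
Implicit Types (T : set X) (F G : set (X -> K)).

(** The filtration by degree in the generators [F], kept as exact functions on [X]. Relations such
    as a prescribed trace hold only on [T]; [words_on] and [alg] account for them. *)
Inductive words F : nat -> (X -> K) -> Prop :=
| words_cst D c : words F D (fun=> c)
| words_add D f g : words F D f -> words F D g -> words F D (fun x => f x + g x)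
| words_gen D f g : F f -> words F D g -> words F D.+1 (fun x => f x * g x).

Definition words_on T F D g :=
  exists2 g', words F D g' & forall x, T x -> g x = g' x.

Definition alg T F g := exists D, words_on T F D g.

Definition spanned T (I : finType) (e : I -> X -> K) g :=
  exists c : I -> K, forall x, T x -> g x = \sum_i c i * e i x.

(* The Hilbert function of the algebra generated by F on T is O(D ^ n). *)
Definition growth T F n := exists C, forall D,
  exists (I : finType) (e : I -> X -> K),
    (#|I| <= C * D.+1 ^ n)%N /\ forall g, words F D g -> spanned T e g.

Lemma words_ext F D f g : words F D f -> f =1 g -> words F D g.
Proof. by move=> wf /funext<-. Qed.

Lemma words_mono F D D' f : (D <= D')%N -> words F D f -> words F D' f.
Proof.
move=> le_DD' wf; elim: wf D' le_DD' => {D f} [D c|D f g _ IHf _ IHg|D f g Ff _ IHg] D'.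
- by move=> _; exact: words_cst.
- by move=> le_DD'; apply: words_add; [exact: IHf|exact: IHg].
- by case: D' => // D' le_DD'; apply: words_gen => //; exact: IHg.
Qed.

Lemma words_mul F D D' f g :
  words F D f -> words F D' g -> words F (D + D') (fun x => f x * g x).
Proof.
move=> wf wg; elim: wf => {D f} [D c|D f h _ IHf _ IHh|D f h Ff _ IHh].
- elim: wg => {D' g} [D' c'|D' f g _ IHf _ IHg|D' f g Ff _ IHg].
  + exact: words_cst.
  + by apply: words_ext (words_add IHf IHg) _ => x; rewrite mulrDr.
  + rewrite addnS; apply: words_ext (words_gen Ff IHg) _ => x.
    by rewrite mulrCA.
- by apply: words_ext (words_add IHf IHh) _ => x; rewrite mulrDl.
- by rewrite addSn; apply: words_ext (words_gen Ff IHh) _ => x; rewrite mulrA.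
Qed.

Lemma words_exp F d g k : words F d g -> words F (d * k) (fun x => g x ^+ k).
Proof.
move=> wg; elim: k => [|k IH].
  by apply: words_ext (words_cst F _ 1) _ => x; rewrite expr0.
by rewrite mulnS; apply: words_ext (words_mul wg IH) _ => x; rewrite exprS.
Qed.

Lemma alg_on_ext T F f g : alg T F f -> (forall x, T x -> f x = g x) -> alg T F g.
Proof.
move=> [D [f' wf' ff']] fg; exists D, f' => // x Tx.
by rewrite -fg// ff'.
Qed.

Lemma alg_funring T F : funring (alg T F).
Proof.
split=> [c|f g [D [f' wf' ff']] [D' [g' wg' gg']]|
         f g [D [f' wf' ff']] [D' [g' wg' gg']]].
- by exists 0%N, (fun=> c) => //; exact: words_cst.
- exists (maxn D D'), (fun x => f' x + g' x) => [|x Tx]; last by rewrite ff' ?gg'.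
  by apply: words_add; [apply: words_mono wf'|apply: words_mono wg'];
    rewrite ?leq_maxl ?leq_maxr.
- exists (D + D')%N, (fun x => f' x * g' x) => [|x Tx]; last by rewrite ff' ?gg'.
  exact: words_mul.
Qed.

Lemma alg_gen T F f : F f -> alg T F f.
Proof.
move=> Ff; exists 1%N, f => //.
by apply: words_ext (words_gen Ff (words_cst F 0 1)) _ => x; rewrite mulr1.
Qed.

Lemma words_sub F G d D g : (forall f, G f -> words F d f) ->
  words G D g -> words F (d * D) g.
Proof.
move=> GF; elim=> {D g} [D c|D f g _ IHf _ IHg|D f g Gf _ IHg].
- exact: words_cst.
- exact: words_add.
- by rewrite mulnS; apply: words_mul => //; exact: GF.
Qed.

Lemma alg_sub T F G g : F `<=` G -> alg T F g -> alg T G g.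
Proof.
move=> FG [D [g' wg' gg']]; exists (1 * D)%N, g' => //; apply: words_sub wg' => f Ff.
apply: words_ext (words_gen (FG _ Ff) (words_cst G 0 1)) _ => x.
by rewrite mulr1.
Qed.

Lemma spanned_on T T' (I : finType) (e : I -> X -> K) g :
  T' `<=` T -> spanned T e g -> spanned T' e g.
Proof. by move=> sT [c ce]; exists c => x /sT; exact: ce. Qed.

Lemma growth_scale C c D n :
  (C * (c * D).+1 ^ n <= C * c.+1 ^ n * D.+1 ^ n)%N.
Proof.
rewrite -mulnA -expnMn leq_mul2l; apply/orP; right.
have [->|n0] := posnP n; first by rewrite !expn0.
by rewrite leq_exp2r// mulSn mulnS addSn ltnS addnA leq_addl.
Qed.

Lemma growth_empty T : growth T set0 0.
Proof.
exists 1%N => D; exists unit, (fun _ _ => 1); split; first by rewrite card_unit.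
move=> g wg; suff [c gc] : exists c, forall x, g x = c.
  by exists (fun=> c) => x _; rewrite gc big_const card_unit /= mulr1 addr0.
elim: wg => {D g} [D c|D f g _ [c fc] _ [c' gc]|D f g []//]; first by exists c.
by exists (c + c') => x; rewrite fc gc.
Qed.

Lemma growth_subset T T' F n : T' `<=` T -> growth T F n -> growth T' F n.
Proof.
move=> sT [C HC]; exists C => D; have [I [e [cI eI]]] := HC D.
by exists I, e; split=> // g /eI; exact: spanned_on.
Qed.

Lemma growth_union T T' F n :
  growth T F n -> growth T' F n -> growth (T `|` T') F n.
Proof.
move=> [C HC] [C' HC']; exists (C + C')%N => D.
have [I [e [cI eI]]] := HC D; have [I' [e' [cI' eI']]] := HC' D.
exists (I + I')%type, (fun ii x => match ii with
   inl i => if `[< T x >] then e i x else 0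
   | inr i => if `[< T x >] then 0 else e' i x end); split.
  by rewrite card_sum mulnDl leq_add.
move=> g wg; have [c gc] := eI _ wg; have [c' gc'] := eI' _ wg.
exists (fun ii => match ii with inl i => c i | inr i => c' i end) => x TT'x.
rewrite big_sumType /=; have [Tx|nTx] := pselect (T x).
  rewrite asboolT // [X in _ + X]big1 ?addr0 ?gc// => i _; exact: mulr0.
rewrite asboolF // big1 ?add0r ?gc'// => [|i _]; last exact: mulr0.
by case: TT'x.
Qed.

Lemma growth_cover (J : finType) T (U : J -> set X) F n :
  (forall j, growth (U j) F n) -> (forall x, T x -> exists j, U j x) -> growth T F n.
Proof.
move=> gU TU.
suff: growth (fun x => exists2 j, j \in enum J & U j x) F n.
  by apply: growth_subset => x /TU[j Ujx]; exists j; rewrite ?mem_enum.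
elim: (enum J) => [|j s IH].
  exists 0%N => D; exists void, (fun _ _ => 0); split; first by rewrite card_void.
  by move=> g _; exists (fun=> 0) => x [].
apply: growth_subset (growth_union (gU j) IH) => x [k].
rewrite inE => /orP[/eqP->|ks] Ukx; first by left.
by right; exists k.
Qed.

Lemma words_adjoin_var F z D g : words ([set z] `|` F) D g ->
  exists h : nat -> X -> K, (forall k, words F D (h k)) /\
    forall x, g x = \sum_(k < D.+1) h k x * z x ^+ k.
Proof.
elim=> {D g} [D c|D f g _ [h [wh fh]] _ [h' [wh' gh']]|D f g Ff _ [h [wh gh]]].
- exists (fun k _ => if k == 0%N then c else 0); split.
    by move=> k; exact: words_cst.
  move=> x; rewrite big_ord_recl big1 /= ?addr0 ?expr0 ?mulr1// => i _.
  by rewrite mul0r.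
- exists (fun k x => h k x + h' k x); split=> [k|x]; first exact: words_add.
  by rewrite fh gh' -big_split; apply: eq_bigr => k _; rewrite /= mulrDl.
case: Ff => [->|Ff].
- exists (fun k x => if k is k'.+1 then h k' x else 0); split=> [[|k]|x].
  + exact: words_cst.
  + exact: words_mono (wh k).
  rewrite big_ord_recl /= mul0r add0r gh mulr_sumr; apply: eq_bigr => k _.
  by rewrite /bump /= add1n exprS mulrCA.
- exists (fun k x => if (k < D.+1)%N then f x * h k x else 0); split=> [k|x].
    by case: (k < D.+1)%N; [exact: words_gen|exact: words_cst].
  rewrite big_ord_recr /= ltnn mul0r addr0 gh mulr_sumr; apply: eq_bigr => k _.
  by rewrite ltn_ord mulrA.
Qed.

(** Expanding in powers of [z] gives [D.+1] exponents, each with a coefficient of degree at most [D]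
    in [F]: one more factor [D.+1]. *)
Lemma growth_adjoin_var T F n z :
  growth T F n -> growth T ([set z] `|` F) n.+1.
Proof.
move=> [C HC]; exists C => D; have [I [e [cI eI]]] := HC D.
exists (I * 'I_D.+1)%type, (fun (p : I * 'I_D.+1) x => e p.1 x * z x ^+ p.2); split.
  by rewrite card_prod card_ord expnSr mulnA leq_mul2r cI orbT.
move=> g /words_adjoin_var[h [wh gh]].
have /choice[c hc] k : exists c : I -> K, forall x, T x -> h k x = \sum_i c i * e i x.
  exact: eI.
exists (fun p : I * 'I_D.+1 => c p.2 p.1) => x Tx; rewrite gh.
rewrite -(pair_bigA _ (fun i k => c (k : 'I_D.+1) i * (e i x * z x ^+ k))) exchange_big /=.
apply: eq_bigr => k _; rewrite hc// mulr_suml.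
by apply: eq_bigr => i _; rewrite mulrA.
Qed.

(** Over the common denominator [q ^+ D], the numerator has degree at most [d.+1 * D]. Such a
    rescaling of the degree affects only the constant in [growth]. *)
Lemma words_adjoin_inv T F q q' d D g :
  words F d q' -> (forall x, T x -> q x = q' x) -> (forall x, T x -> q x != 0) ->
  words ([set (fun x => (q x)^-1)] `|` F) D g ->
  exists2 h, words F (d.+1 * D) h & forall x, T x -> g x = h x / q x ^+ D.
Proof.
move=> wq qq' q0; elim=> {D g} [D c|D f g _ [h wh fh] _ [h' wh' gh']|D f g Ff _ [h wh gh]].
- exists (fun x => c * q' x ^+ D) => [|x Tx]; last by rewrite -qq'// mulfK// expf_neq0 ?q0.
  apply: (@words_mono _ (0 + d * D)); first by rewrite mulSn leq_add2r.
  by apply: words_mul; [exact: words_cst|exact: words_exp].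
- exists (fun x => h x + h' x) => [|x Tx]; first exact: words_add.
  by rewrite fh ?gh'// mulrDl.
case: Ff => [->|Ff].
- exists h => [|x Tx]; first by apply: words_mono wh; rewrite leq_mul2l leqnSn orbT.
  by rewrite gh// exprSr invfM mulrCA [(q x)^-1 * _]mulrC.
- exists (fun x => q' x * (f x * h x)) => [|x Tx].
    have := words_mul wq (words_gen Ff wh); apply: words_mono.
    by rewrite mulnS addnS addSn.
  rewrite gh// -qq'// exprS; have qx0 := q0 x Tx.
  have : q x ^+ D != 0 by rewrite expf_neq0.
  by move: (q x ^+ D) => Q Q0; field; rewrite Q0.
Qed.

Lemma growth_adjoin_inv T F n q :
  growth T F n -> alg T F q -> (forall x, T x -> q x != 0) ->
  growth T ([set (fun x => (q x)^-1)] `|` F) n.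
Proof.
move=> [C HC] [d [q' wq' qq']] q0; exists (C * d.+2 ^ n)%N => D.
have [I [e [cI eI]]] := HC (d.+1 * D)%N.
exists I, (fun i x => e i x / q x ^+ D); split.
  exact: leq_trans cI (growth_scale _ _ _ _).
move=> g /(words_adjoin_inv wq' qq' q0)[h wh gh].
have [c hc] := eI _ wh; exists c => x Tx; rewrite gh// hc// mulr_suml.
by apply: eq_bigr => i _; rewrite mulrA.
Qed.

(** Reduction by the quadratic relation leaves only [1] and [z] over the words in [F]. Up to
    rescaling the degree by [d.+1], the number of spanning functions doubles. *)
Lemma words_adjoin_quad T F z a b d D g :
  words F d a -> words F d b -> (forall x, T x -> z x ^+ 2 = a x * z x + b x) ->
  words ([set z] `|` F) D g ->
  exists h h', [/\ words F (d.+1 * D) h, words F (d.+1 * D) h' &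
    forall x, T x -> g x = h x + h' x * z x].
Proof.
move=> wa wb zz; elim=> {D g} [D c|D f g _ [f1 [f2 [wf1 wf2 ff]]] _ [g1 [g2 [wg1 wg2 gg]]]|
   D f g Ff _ [g1 [g2 [wg1 wg2 gg]]]].
- by exists (fun=> c), (fun=> 0); split=> [||x _];
    [exact: words_cst|exact: words_cst|rewrite mul0r addr0].
- exists (fun x => f1 x + g1 x), (fun x => f2 x + g2 x); split=> [||x Tx].
  + exact: words_add.
  + exact: words_add.
  + by rewrite ff ?gg//; ring.
case: Ff => [->|Ff].
- exists (fun x => b x * g2 x), (fun x => g1 x + a x * g2 x); split=> [||x Tx].
  + by apply: words_mono (words_mul wb wg2); rewrite mulnS leq_add2r.
  + apply: words_add; first by apply: words_mono wg1; rewrite leq_mul2l leqnSn orbT.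
    by apply: words_mono (words_mul wa wg2); rewrite mulnS leq_add2r.
  + have -> : z x * g x = g1 x * z x + g2 x * z x ^+ 2 by rewrite gg//; ring.
    by rewrite zz//; ring.
- exists (fun x => f x * g1 x), (fun x => f x * g2 x); split=> [||x Tx].
  + by apply: words_mono (words_gen Ff wg1); rewrite mulnS addSn ltnS leq_addl.
  + by apply: words_mono (words_gen Ff wg2); rewrite mulnS addSn ltnS leq_addl.
  + by rewrite gg//; ring.
Qed.

Lemma growth_adjoin_quad T F n z a b :
  growth T F n -> alg T F a -> alg T F b ->
  (forall x, T x -> z x ^+ 2 = a x * z x + b x) -> growth T ([set z] `|` F) n.
Proof.
move=> [C HC] [da [a' wa aa']] [db [b' wb bb']] zz.
pose d := maxn da db.
have {}wa : words F d a' by apply: words_mono wa; exact: leq_maxl.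
have {}wb : words F d b' by apply: words_mono wb; exact: leq_maxr.
have {}zz x : T x -> z x ^+ 2 = a' x * z x + b' x by move=> Tx; rewrite zz// aa'// bb'.
exists (2 * (C * d.+2 ^ n))%N => D; have [I [e [cI eI]]] := HC (d.+1 * D)%N.
exists (I + I)%type, (fun ii x => match ii with inl i => e i x | inr i => e i x * z x end).
split.
  by rewrite card_sum addnn -mul2n -mulnA leq_mul2l (leq_trans cI (growth_scale _ _ _ _)).
move=> g /(words_adjoin_quad wa wb zz)[h [h' [wh wh' gh]]].
have [c hc] := eI _ wh; have [c' hc'] := eI _ wh'.
exists (fun ii => match ii with inl i => c i | inr i => c' i end) => x Tx.
rewrite big_sumType /= gh// hc// hc'// mulr_suml; congr (_ + _).
by apply: eq_bigr => i _; rewrite mulrA.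
Qed.

End Growth.

(** No map from [S] to the parameters is required: each point needs some parameter at which the
    functions [r j] take the values [G j]. *)
Lemma growth_pull (K : fieldType) (X V : Type) (T : set X) (F : set (X -> K))
    (S : set V) (J : finType) (G : J -> V -> K) (r : J -> X -> K) n :
  growth T F n -> (forall j, alg T F (r j)) ->
  (forall v, S v -> exists2 x, T x & forall j, G j v = r j x) ->
  growth S [set f | exists j, f = G j] n.
Proof.
move=> [C HC] /choice[d rd] ST.
have {rd} /choice[r' rr'] j : exists r', words F (\max_j d j) r' /\ forall x, T x -> r j x = r' x.
  have [r' wr' rr'] := rd j; exists r'; split=> //.
  exact: words_mono (leq_bigmax j) wr'.
set m := \max_j d j in rr'.
have GX D g : words [set f | exists j, f = G j] D g -> exists2 g', words F (m * D) g' &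
    forall v x, S v -> T x -> (forall j, G j v = r j x) -> g v = g' x.
  elim=> {D g} [D c|D f g _ [f' wf ff'] _ [g' wg gg']|D f g [j ->] _ [g' wg gg']].
  - by exists (fun=> c) => //; exact: words_cst.
  - exists (fun x => f' x + g' x) => [|v x Sv Tx vx]; first exact: words_add.
    by rewrite (ff' v x)// (gg' v x).
  - exists (fun x => r' j x * g' x) => [|v x Sv Tx vx].
      by rewrite mulnS; apply: words_mul wg; exact: (rr' j).1.
    by rewrite vx (rr' j).2// (gg' v x).
exists (C * m.+1 ^ n)%N => D; have [I [e [cI eI]]] := HC (m * D)%N.
(* Parameters need not be unique; fixing one for each point turns the spanning functions on [X] into
   functions on [S]. *)
have /choice[y Hy] v : exists y : I -> K, S v ->
    exists2 x, T x /\ (forall j, G j v = r j x) & forall i, y i = e i x.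
  have [Sv|nSv] := pselect (S v); last by exists (fun=> 0).
  by have [x Tx vx] := ST _ Sv; exists (e^~ x) => _; exists x.
exists I, (fun i v => y v i); split; first exact: leq_trans cI (growth_scale _ _ _ _).
move=> g /GX[g' wg' gg']; have [c gc] := eI _ wg'.
exists c => v Sv; have [x [Tx vx] yx] := Hy v Sv.
by rewrite (gg' v x)// gc//; apply: eq_bigr => i _; rewrite yx.
Qed.

(** * Chains of irreducible sets against Hilbert functions *)

Section ChainBound.
Local Open Scope classical_set_scope.
Variables (K : fieldType) (V : vectType K).
Implicit Types (S : set V).

Definition coords : set (V -> K) := [set f | exists i, f = coord (vbasis {:V}) i].

Definition independent_on S (I : finType) (h : I -> V -> K) :=
  forall c : I -> K, (forall v, S v -> \sum_i c i * h i v = 0) -> forall i, c i = 0.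

Lemma card_independent S (I J : finType) (h : I -> V -> K) (e : J -> V -> K) :
  independent_on S h -> (forall i, spanned S e (h i)) -> (#|I| <= #|J|)%N.
Proof.
move=> indh /choice[c hc]; rewrite leqNgt; apply/negP => ltJI.
pose A : 'M[K]_(#|I|, #|J|) := \matrix_(i, j) c (enum_val i) (enum_val j).
have : kermx A != 0.
  rewrite kermx_eq0 -row_leq_rank -ltnNge.
  exact: leq_ltn_trans (rank_leq_col A) ltJI.
case/rowV0Pn => u /sub_kermxP uA /negP[]; apply/eqP/rowP => k; rewrite mxE.
have := indh (fun i => u 0 (enum_rank i)); rewrite -(enum_valK k); apply=> v Sv.
have -> : \sum_i u 0 (enum_rank i) * h i v =
    \sum_j (\sum_i u 0 (enum_rank i) * c i j) * e j v.
  under eq_bigr => i _ do rewrite hc// mulr_sumr.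
  rewrite exchange_big; apply: eq_bigr => j _; rewrite mulr_suml.
  by apply: eq_bigr => i _; rewrite mulrA.
rewrite big1 // => j _; have /rowP/(_ (enum_rank j)) := uA; rewrite !mxE.
rewrite (reindex (@enum_rank I)) /=; last by apply: onW_bij; exact: enum_rank_bij.
under eq_bigr => i _ do rewrite mxE !enum_rankK.
by move=> ->; rewrite mul0r.
Qed.

Lemma words_regular f : regular f -> exists d, words coords d f.
Proof.
move=> rf; suff [d [f' wf ff']] : alg setT coords f.
  by exists d; apply: words_ext wf _ => v; rewrite ff'.
apply: (regular_comp (phi := id) (alg_funring _ _)) rf => i.
by apply: alg_gen; exists i.
Qed.

Lemma words_coords_regular D f : words coords D f -> regular f.
Proof.
have RF := @regular_funring K V.
elim=> {D f} [D c|D f g _ rf _ rg|D f g [i ->] _ rg].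
- exact: (funring_cst RF).
- exact: (funring_add RF).
- by apply: (funring_mul RF) => //; exact: regular_coord.
Qed.

(** In a vanishing combination the lowest power of [g] can be divided out, since [Z'] is integral
    and [g] is not identically zero on it. On [Z], where [g] vanishes, the quotient restricts to a
    relation among the [h i]. *)
Lemma independent_powers (Z Z' : set V) (I : finType) (h : I -> V -> K) g N :
  Z `<=` Z' -> integral_on Z' -> regular g -> (forall i, regular (h i)) ->
  (forall v, Z v -> g v = 0) -> (exists2 v, Z' v & g v <> 0) ->
  independent_on Z h ->
  independent_on Z' (fun (p : I * 'I_N) v => h p.1 v * g v ^+ p.2).
Proof.
move=> ZZ' intZ' rg rh gZ [w Z'w gw] indh c sum0.
have RF := @regular_funring K V.
suff cz k : forall j : 'I_N, j = k :> nat -> forall i, c (i, j) = 0.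
  by move=> [i j]; exact: (cz j).
have [n] := ubnP k; elim: n k => // n IH k; rewrite ltnS => le_kn j jk i.
have cz (i' : I) (j' : 'I_N) : (j' < k)%N -> c (i', j') = 0.
  by move=> lt_jk; apply: (IH j') => //; exact: leq_trans le_kn.
(* [s] is the relation divided by [g ^+ k], the coefficients of lower powers being zero by
   induction. *)
pose s v := \sum_(p : I * 'I_N | (k <= p.2)%N) c p * (h p.1 v * g v ^+ (p.2 - k)).
have rs : regular s.
  apply: (funring_sum RF) => p _; apply: (funring_mul RF).
    exact: (funring_cst RF).
  by apply: (funring_mul RF) => //; exact: (funring_exp RF).
have gs v : Z' v -> g v ^+ k * s v = 0.
  move=> Z'v; rewrite -[RHS](sum0 v Z'v) [RHS](bigID (fun p : I * 'I_N => (k <= p.2)%N)) /=.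
  rewrite [X in _ + X]big1 => [|[i' j'] /=]; last by rewrite -ltnNge => /cz->; rewrite mul0r.
  rewrite addr0 mulr_sumr; apply: eq_bigr => p kp.
  by rewrite -{2}(subnKC kp) exprD; ring.
have [gk0|s0] := intZ' _ _ (funring_exp RF k rg) rs gs.
  by have /eqP := gk0 w Z'w; rewrite expf_eq0 => /andP[_ /eqP].
apply: (indh (fun i => c (i, j))) => v Zv; rewrite -[RHS](s0 v (ZZ' v Zv)) /s.
rewrite (bigID (fun p => p.2 == j)) /= [X in _ + X]big1 => [|[i' j'] /= /andP[kj' nj]].
  rewrite addr0 (eq_bigl (fun p => p.2 == j)); last first.
    by move=> [i' j'] /=; case: eqP => [->|]; rewrite ?andbF// jk leqnn.
  rewrite (reindex (fun i => (i, j))) /=; last first.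
    exists fst => [//|[i' j']]; rewrite inE /= => /eqP->//.
  by apply: eq_big => [i'|i' _]; rewrite ?eqxx//= jk subnn expr0 mulr1.
rewrite gZ// expr0n subn_eq0 leqNgt ltn_neqAle kj' -jk eq_sym.
by rewrite (_ : (_ == _ :> nat) = false) ?mulr0 ?mulr0//; apply/negbTE.
Qed.

(** Each step of the chain supplies one function that separates it, used with exponents up to [D];
    [m] is the sum of the degrees of these functions. *)
Lemma zchain_independent S e Z : zchain S e Z ->
  exists m, forall D, exists (I : finType) (h : I -> V -> K),
    [/\ #|I| = (D.+1 ^ e)%N, forall i, words coords (m * D) (h i)
      & independent_on (Z e) h].
Proof.
elim: e => [|e IH] [Zk ZS].
  have [_ [[z Zz] _]] := Zk 0%N isT.
  exists 0%N => D; exists unit, (fun _ _ => 1); split; first by rewrite card_unit.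
    by move=> _; exact: words_cst.
  move=> c /(_ z Zz); rewrite (big_pred1 tt) => [|[]//].
  by rewrite mulr1 => c0 [].
have {IH}[|m Hm] := IH.
  by split=> k lek; [apply: Zk|apply: ZS]; rewrite ltnW.
have [[Ie defZe] _] := Zk e (leqnSn e).
have [[I' defZ'] irrZ'] := Zk e.+1 (leqnn _).
have [Zsub /existsNP[w /not_implyP[Z'w nZw]]] := ZS e (leqnn _).
have Sw : S w by move: Z'w; rewrite defZ' => -[].
have [p [Ip pw]] : exists p, Ie p /\ poly_eval p w <> 0.
  apply: contrapT => noP; apply: nZw; rewrite defZe; split=> // p Ip.
  by apply: contrapT => pw; apply: noP; exists p.
pose g := poly_eval p; have rg : regular g by exact: regular_poly.
have gZ v : Z e v -> g v = 0 by rewrite defZe => -[_]; apply.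
have [d wg] := words_regular rg.
exists (m + d)%N => D; have [I [h [cI wh indh]]] := Hm D.
exists (I * 'I_D.+1)%type, (fun (q : I * 'I_D.+1) v => h q.1 v * g v ^+ q.2); split.
- by rewrite card_prod card_ord cI expnSr.
- move=> [i k] /=; apply: words_mono (words_mul (wh i) (words_exp k wg)).
  by rewrite mulnDl leq_add2l leq_mul2l -ltnS ltn_ord orbT.
apply: independent_powers indh => //.
- exact: zirreducible_integral.
- by move=> i; exact: words_coords_regular (wh i).
- by exists w.
Qed.

Lemma zchain_growth S e Z n : zchain S e Z -> growth S coords n -> (e <= n)%N.
Proof.
move=> chZ [C HC]; have [m Hm] := zchain_independent chZ.
rewrite leqNgt; apply/negP => lt_ne.
(* For this [D], the bound [C * (m * D).+1 ^ n] is at most [D * D.+1 ^ n], which is smaller than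
   [D.+1 ^ n.+1]. *)
set D := (C * m.+1 ^ n)%N; have [I [h [cI wh indh]]] := Hm D.
have [J [f [cJ fJ]]] := HC (m * D)%N.
have ZS : Z e `<=` S by have [[I' ->] _] := chZ.1 e (leqnn _); move=> v [].
have le1 : (#|I| <= #|J|)%N.
  by apply: card_independent indh _ => i; apply: spanned_on ZS _; apply: fJ; exact: wh.
have : (D.+1 ^ n.+1 <= D * D.+1 ^ n)%N.
  apply: (@leq_trans (D.+1 ^ e)); first by rewrite leq_pexp2l.
  rewrite -cI; apply: leq_trans le1 (leq_trans cJ _).
  exact: growth_scale.
by rewrite expnS leq_mul2r ltnn orbF expn_eq0.
Qed.

End ChainBound.

(** * Matrices with prescribed invariants as generators *)

Section Adjoining.
Local Open Scope classical_set_scope.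
Variables (K : fieldType) (X : Type) (T : set X).
Implicit Types (F : set (X -> K)).

Lemma mx_in_on m n F (M N : X -> 'M[K]_(m, n)) :
  mx_in (alg T F) M -> (forall x, T x -> M x = N x) -> mx_in (alg T F) N.
Proof. by move=> aM MN i j; apply: alg_on_ext (aM i j) _ => x /MN->. Qed.

Lemma mx_in_sub m n F F' (M : X -> 'M[K]_(m, n)) :
  F `<=` F' -> mx_in (alg T F) M -> mx_in (alg T F') M.
Proof. by move=> sF aM i j; exact: alg_sub (aM i j). Qed.

Lemma growth_adjoin_family F n (J : finType) (r : J -> X -> K) : growth T F n ->
  exists F', [/\ growth T F' (#|J| + n), F `<=` F' & forall j, F' (r j)].
Proof.
move=> gF; rewrite cardT; suff [F' [gF' sF rF']] : exists F',
    [/\ growth T F' (size (enum J) + n), F `<=` F' & {in enum J, forall j, F' (r j)}].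
  by exists F'; split=> // j; apply: rF'; rewrite mem_enum.
elim: (enum J) => [|j s [F' [gF' sF rF']]]; first by exists F; split.
exists ([set r j] `|` F'); split=> [|f /sF|i]; first exact: growth_adjoin_var.
  by right.
by rewrite inE => /orP[/eqP->|/rF']; [left|right].
Qed.

Lemma mx_in2 F (A : X -> 'M[K]_2) :
  alg T F (fun x => A x 0 0) -> alg T F (fun x => A x 0 1) ->
  alg T F (fun x => A x 1 0) -> alg T F (fun x => A x 1 1) -> mx_in (alg T F) A.
Proof. by move=> a b c d; apply: ord2P; apply: ord2P. Qed.

(** The off-diagonal entries [b], [c] are the two parameters: [A 0 0] is a root of
    [X^2 - t X + (d + b c)] and [A 1 1] is [t - A 0 0]. *)
Lemma growth_adjoin_mx2 F n (A : X -> 'M[K]_2) t d :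
  growth T F n -> (forall x, T x -> \tr (A x) = t) -> (forall x, T x -> \det (A x) = d) ->
  exists F', [/\ growth T F' n.+2, F `<=` F' & mx_in (alg T F') A].
Proof.
move=> gF trA detA.
pose F1 := [set (fun x => A x 1 0)] `|` ([set (fun x => A x 0 1)] `|` F).
pose F2 := [set (fun x => A x 0 0)] `|` F1.
have gF1 : growth T F1 n.+2 by do 2 apply: growth_adjoin_var.
have AF1 := @alg_funring K X T F1; have AF2 := @alg_funring K X T F2.
have sF : F `<=` F2 by do 3 right.
exists F2; split=> //.
  apply: (@growth_adjoin_quad K X T F1 n.+2 _ (fun=> t) (fun x => - (d + A x 0 1 * A x 1 0))).
  - by [].
  - exact: (funring_cst AF1).
  - apply: (funring_opp AF1); apply: (funring_add AF1); first exact: (funring_cst AF1).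
    by apply: (funring_mul AF1); apply: alg_gen; [right; left|left].
  - move=> x Tx; rewrite -(trA x Tx) -(detA x Tx) mx2_trace mx2_det; ring.
have a00 : alg T F2 (fun x => A x 0 0) by apply: alg_gen; left.
apply: mx_in2 => //.
- by apply: alg_gen; right; right; left.
- by apply: alg_gen; right; left.
- apply: alg_on_ext (funring_sub AF2 (funring_cst AF2 t) a00) _ => x Tx.
  by rewrite -(trA x Tx) mx2_trace addrC addKr.
Qed.

(* The matrices B with fixed trace, determinant and trace of C *m B form a conic,
   parametrized up to a quadratic equation by B 1 0. *)
Lemma growth_adjoin_conic F n (C B : X -> 'M[K]_2) t d k :
  growth T F n -> mx_in (alg T F) C -> (forall x, T x -> C x 1 0 != 0) ->
  (forall x, T x -> \tr (B x) = t) -> (forall x, T x -> \det (B x) = d) ->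
  (forall x, T x -> \tr (C x *m B x) = k) ->
  exists F', [/\ growth T F' n.+1, F `<=` F' & mx_in (alg T F') B].
Proof.
move=> gF aC C10 trB detB trCB.
pose F1 := [set (fun x => B x 1 0)] `|` ([set (fun x => (C x 1 0)^-1)] `|` F).
pose F2 := [set (fun x => B x 0 0)] `|` F1.
have gF1 : growth T F1 n.+1.
  by apply: growth_adjoin_var; apply: growth_adjoin_inv.
have AF1 := @alg_funring K X T F1; have AF2 := @alg_funring K X T F2.
have sF1 : F `<=` F1 by do 2 right.
have sF2 : F1 `<=` F2 by right.
have aC1 i j : alg T F1 (fun x => C x i j) by apply: alg_sub sF1 _.
have aC2 i j : alg T F2 (fun x => C x i j) by apply: alg_sub sF2 _.
have aV1 : alg T F1 (fun x => (C x 1 0)^-1) by apply: alg_gen; right; left.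
have aV2 := alg_sub sF2 aV1.
have aB1 : alg T F1 (fun x => B x 1 0) by apply: alg_gen; left.
have aB2 := alg_sub sF2 aB1.
have tr2 x : T x -> B x 1 1 = t - B x 0 0.
  by move=> Tx; rewrite -(trB x Tx) mx2_trace; ring.
have B01 x : T x -> B x 0 1 =
    (k - C x 1 1 * t - C x 0 1 * B x 1 0 - (C x 0 0 - C x 1 1) * B x 0 0) * (C x 1 0)^-1.
  move=> Tx; have C0 := C10 x Tx; rewrite -(trCB x Tx) mx2_trace !mx2_mulE tr2//.
  by field.
exists F2; split=> [||].
- apply: (@growth_adjoin_quad K X T F1 n.+1 _
    (fun x => t + B x 1 0 * (C x 0 0 - C x 1 1) * (C x 1 0)^-1)
    (fun x => - (d + B x 1 0 * (k - C x 1 1 * t - C x 0 1 * B x 1 0) * (C x 1 0)^-1))).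
  + by [].
  + apply: (funring_add AF1); first exact: (funring_cst AF1).
    by do 2![apply: (funring_mul AF1) => //]; exact: (funring_sub AF1).
  + apply: (funring_opp AF1); apply: (funring_add AF1); first exact: (funring_cst AF1).
    do 2![apply: (funring_mul AF1) => //].
    apply: (funring_sub AF1); last exact: (funring_mul AF1).
    apply: (funring_sub AF1); first exact: (funring_cst AF1).
    by apply: (funring_mul AF1) => //; exact: (funring_cst AF1).
  + move=> x Tx; have C0 := C10 x Tx.
    by rewrite -(detB x Tx) mx2_det tr2// B01//; field.
- exact: subset_trans sF2.
have a00 : alg T F2 (fun x => B x 0 0) by apply: alg_gen; left.
apply: mx_in2 => //.
- apply: (@alg_on_ext K X T F2 (fun x =>
    (k - C x 1 1 * t - C x 0 1 * B x 1 0 - (C x 0 0 - C x 1 1) * B x 0 0) * (C x 1 0)^-1)).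
    apply: (funring_mul AF2) => //; apply: (funring_sub AF2).
      apply: (funring_sub AF2); last exact: (funring_mul AF2).
      apply: (funring_sub AF2); first exact: (funring_cst AF2).
      by apply: (funring_mul AF2) => //; exact: (funring_cst AF2).
    by apply: (funring_mul AF2) => //; exact: (funring_sub AF2).
  by move=> x Tx; rewrite B01.
- apply: alg_on_ext (funring_sub AF2 (funring_cst AF2 t) a00) _ => x Tx.
  by rewrite tr2.
Qed.

(** Transposition exchanges [C 1 0] and [C 0 1] and preserves the three invariants. *)
Lemma growth_adjoin_conic_tr F n (C B : X -> 'M[K]_2) t d k :
  growth T F n -> mx_in (alg T F) C -> (forall x, T x -> C x 0 1 != 0) ->
  (forall x, T x -> \tr (B x) = t) -> (forall x, T x -> \det (B x) = d) ->
  (forall x, T x -> \tr (C x *m B x) = k) ->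
  exists F', [/\ growth T F' n.+1, F `<=` F' & mx_in (alg T F') B].
Proof.
move=> gF aC C01 trB detB trCB.
have [|||||F' [gF' sF aB]] := @growth_adjoin_conic F n (fun x => (C x)^T)
  (fun x => (B x)^T) t d k gF.
- by move=> i j; apply: funring_ext (aC j i) _ => x; rewrite mxE.
- by move=> x Tx; rewrite mxE; exact: C01.
- by move=> x Tx; rewrite mxtrace_tr trB.
- by move=> x Tx; rewrite det_tr detB.
- by move=> x Tx; rewrite -trmx_mul mxtrace_tr mxtrace_mulC trCB.
exists F'; split=> // i j.
by apply: funring_ext (aB j i) _ => x; rewrite mxE.
Qed.

End Adjoining.

(** * Parameters for quadruples and for conjugating matrices *)

Section AdjoiningQuadruples.
Local Open Scope classical_set_scope.
Variables (K : fieldType) (X : Type) (T : set X).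
Implicit Types (F : set (X -> K)).

(** Solving for [B i2] along the conic divides by an off-diagonal entry of [C = B 0 *m B 1]; the
    last chart collects the diagonal [C]. *)
Definition chart (c : 'I_3) (C : 'M[K]_2) : Prop :=
  match val c with
  | 0 => C 1 0 != 0
  | 1 => C 0 1 != 0
  | _ => C 1 0 = 0 /\ C 0 1 = 0
  end.

Lemma chartP (C : 'M[K]_2) : exists c, chart c C.
Proof.
have [C10|C10] := eqVneq (C 1 0) 0; last by exists 0.
have [C01|C01] := eqVneq (C 0 1) 0; last by exists (Ordinal (isT : 1 < 3)%N).
by exists (Ordinal (isT : 2 < 3)%N).
Qed.

(** Put [C = B 0 *m B 1]. The five parameters are 2 + 2 + 1 for [B 0], [B 1], [B i2] if [C] has a
    nonzero off-diagonal entry, and 2 + 1 + 2 for [B 0], [C], [B i2] if [C] is diagonal. Then [B i3]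
    is the inverse of the product of the others. *)
Lemma growth_adjoin_quadruple F n c (B : X -> 'I_4 -> 'M[K]_2) (t d : 'I_4 -> K) :
  growth T F n -> (forall j, d j != 0) ->
  (forall x, T x -> forall j, \tr (B x j) = t j /\ \det (B x j) = d j) ->
  (forall x, T x -> \prod_(j < 4) B x j = 1) ->
  (forall x, T x -> chart c (B x 0 *m B x 1)) ->
  exists F', [/\ growth T F' (5 + n), F `<=` F' & forall j, mx_in (alg T F') (fun x => B x j)].
Proof.
move=> gF d0 Btd Bprod Bc.
have prodE x : T x -> B x 0 *m B x 1 *m B x i2 *m B x i3 = 1%:M.
  by move=> /Bprod; rewrite prod_ord4.
have detB j x : T x -> \det (B x j) = d j by move=> /Btd/(_ j)[].
have trB j x : T x -> \tr (B x j) = t j by move=> /Btd/(_ j)[].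
suff [F' [gF' sF [a0 a1 a2]]] : exists F', [/\ growth T F' (5 + n), F `<=` F' &
    [/\ mx_in (alg T F') (fun x => B x 0), mx_in (alg T F') (fun x => B x 1)
      & mx_in (alg T F') (fun x => B x i2)]].
  have AF := @alg_funring K X T F'.
  exists F'; split=> //; apply: ord4P => //.
  apply: (mx_in_right_inverse AF (@alg_on_ext K X T F') (M := fun x => B x 0 *m B x 1 *m B x i2)).
  - by move=> x Tx; rewrite prodE.
  - apply: alg_on_ext (funring_cst AF (d 0 * d 1 * d i2)^-1) _ => x Tx.
    by rewrite !det_mulmx !detB.
  - by do 2![apply: mx_in_mul => //].
(* In size two the trace of an inverse is the trace divided by the determinant, so the trace of
   [B i3] becomes a condition linear in [B i2]. *)
have trCB x : T x -> \tr (B x 0 *m B x 1 *m B x i2) = t i3 / d i3.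
  move=> Tx; have [_ uB3] := mulmx1_unit (prodE x Tx).
  have -> : B x 0 *m B x 1 *m B x i2 = invmx (B x i3).
    by rewrite -[LHS](mulmxK uB3) prodE// mul1mx.
  rewrite /invmx uB3 mxtraceZ detB// mulrC; congr (_ / _).
  rewrite -(trB i3 x Tx) !mx2_trace !mxE /cofactor !det_mx11 !mxE /= addrC.
  rewrite !expr2 !expr0 !mul1r ?mulN1r ?opprK ?mul1r.
  by congr (B _ _ _ _ + B _ _ _ _); exact/val_inj.
have [F1 [gF1 sF1 aB0]] := growth_adjoin_mx2 gF (trB 0) (detB 0).
case: c Bc => [[|[|[|//]]] ltc]; rewrite /chart /= => Bc.
- have [F2 [gF2 sF2 aB1]] := growth_adjoin_mx2 gF1 (trB 1) (detB 1).
  have AF2 := @alg_funring K X T F2.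
  have aB02 := mx_in_sub sF2 aB0.
  have [F3 [gF3 sF3 aB2]] := growth_adjoin_conic gF2 (mx_in_mul AF2 aB02 aB1)
    Bc (trB i2) (detB i2) trCB.
  exists F3; split=> //; first exact: subset_trans sF1 (subset_trans sF2 sF3).
  by split=> //; exact: mx_in_sub sF3 _.
- have [F2 [gF2 sF2 aB1]] := growth_adjoin_mx2 gF1 (trB 1) (detB 1).
  have AF2 := @alg_funring K X T F2.
  have aB02 := mx_in_sub sF2 aB0.
  have [F3 [gF3 sF3 aB2]] := growth_adjoin_conic_tr gF2 (mx_in_mul AF2 aB02 aB1)
    Bc (trB i2) (detB i2) trCB.
  exists F3; split=> //; first exact: subset_trans sF1 (subset_trans sF2 sF3).
  by split=> //; exact: mx_in_sub sF3 _.
(* On the chart where C = B 0 *m B 1 is diagonal, C has one free entry. *)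
pose C x := B x 0 *m B x 1.
pose F2 := [set (fun x => C x 0 0)] `|` F1.
pose F3 := [set (fun x => (C x 0 0)^-1)] `|` F2.
have gF2 : growth T F2 n.+3 by exact: growth_adjoin_var.
have detC x : T x -> C x 0 0 * C x 1 1 = d 0 * d 1.
  move=> Tx; have [C10 C01] := Bc x Tx.
  by rewrite -(detB 0 x Tx) -(detB 1 x Tx) -det_mulmx mx2_det C10 mulr0 subr0.
have C00 x : T x -> C x 0 0 != 0.
  move=> Tx; apply/eqP => C0; have /eqP := detC x Tx.
  by rewrite C0 mul0r eq_sym mulf_eq0 (negbTE (d0 0)) (negbTE (d0 1)).
have a00 : alg T F2 (fun x => C x 0 0) by apply: alg_gen; left.
have gF3 : growth T F3 n.+3 by exact: growth_adjoin_inv.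
have AF3 := @alg_funring K X T F3.
have sF13 : F1 `<=` F3 by do 2 right.
have aC : mx_in (alg T F3) C.
  apply: mx_in2.
  - by apply: alg_gen; right; left.
  - by apply: alg_on_ext (funring_cst AF3 0) _ => x /Bc[].
  - by apply: alg_on_ext (funring_cst AF3 0) _ => x /Bc[].
  - have aV : alg T F3 (fun x => (C x 0 0)^-1) by apply: alg_gen; left.
    apply: alg_on_ext (funring_mul AF3 (funring_cst AF3 (d 0 * d 1)) aV) _ => x Tx.
    by rewrite -(detC x Tx) mulrAC divff ?mul1r ?C00.
have aB03 := mx_in_sub sF13 aB0.
have aB1 : mx_in (alg T F3) (fun x => B x 1).
  apply: (mx_in_on (M := fun x => (d 0)^-1 *: (\adj (B x 0) *m C x))).
    apply: (mx_in_scale AF3 (funring_cst AF3 _)).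
    by apply: (mx_in_mul AF3) aC; exact: mx_in_adj.
  move=> x Tx; rewrite /C mulmxA mul_adj_mx detB// mul_scalar_mx scalerA.
  by rewrite mulVf ?d0 // scale1r.
have [F4 [gF4 sF4 aB2]] := growth_adjoin_mx2 gF3 (trB i2) (detB i2).
exists F4; split=> //; first exact: subset_trans sF1 (subset_trans sF13 sF4).
by split=> //; exact: mx_in_sub sF4 _.
Qed.

(** Up to left multiplication by [GL(2)], each 2 x 4 half of an invertible matrix is a point of a
    Grassmannian; [f] and [g] select affine charts in which the chosen columns form the identity. *)
Definition frames (f g : 'I_2 -> 'I_4) (Q : 'M[K]_(2 + 2)) :=
  [/\ colsub f (usubmx Q) = 1%:M, colsub g (dsubmx Q) = 1%:M & Q \in unitmx].

Lemma card_notin_codom (f : 'I_2 -> 'I_4) : injective f ->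
  #|[predC codom f]| = 2%N.
Proof.
move=> injf; have := cardC (mem (codom f)).
by rewrite card_codom// !card_ord => /(@addnI 2 _ 2).
Qed.

(** Four entries of each half lie outside the selected columns. Besides them the inverse of [Q]
    needs only [(\det Q)^-1], which does not raise the exponent. *)
Lemma growth_adjoin_frame F n (f g : 'I_2 -> 'I_4) (Q : X -> 'M[K]_(2 + 2)) :
  injective f -> injective g -> growth T F n -> (forall x, T x -> frames f g (Q x)) ->
  exists F', [/\ growth T F' (8 + n), F `<=` F', mx_in (alg T F') Q
    & mx_in (alg T F') (fun x => invmx (Q x))].
Proof.
move=> injf injg gF TQ.
pose J1 := ('I_2 * 'I_#|[predC codom f]|)%type.
pose J2 := ('I_2 * 'I_#|[predC codom g]|)%type.
have [F1 [gF1 sF1 aF1]] := @growth_adjoin_family K X T F n (J1 + J2)%type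
  (fun j x => match j with
     | inl p => usubmx (Q x) p.1 (enum_val p.2)
     | inr p => dsubmx (Q x) p.1 (enum_val p.2) end) gF.
rewrite card_sum !card_prod !card_ord (card_notin_codom injf) (card_notin_codom injg) in gF1.
have AF1 := @alg_funring K X T F1.
have au : mx_in (alg T F1) (fun x => usubmx (Q x)).
  move=> i j; have [/codomP[k ->]|nf] := boolP (j \in codom f).
    apply: alg_on_ext (funring_cst AF1 ((1%:M : 'M[K]_2) i k)) _ => x Tx.
    by have [<- _ _] := TQ x Tx; rewrite mxE.
  have nf' : j \in [predC codom f] by [].
  rewrite -(enum_rankK_in nf' nf'); apply: alg_gen.
  exact: (aF1 (inl (i, enum_rank_in nf' j))).
have ad : mx_in (alg T F1) (fun x => dsubmx (Q x)).
  move=> i j; have [/codomP[k ->]|nf] := boolP (j \in codom g).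
    apply: alg_on_ext (funring_cst AF1 ((1%:M : 'M[K]_2) i k)) _ => x Tx.
    by have [_ <- _] := TQ x Tx; rewrite mxE.
  have nf' : j \in [predC codom g] by [].
  rewrite -(enum_rankK_in nf' nf'); apply: alg_gen.
  exact: (aF1 (inr (i, enum_rank_in nf' j))).
have aQ : mx_in (alg T F1) Q.
  move=> i j; case: (split_ordP i) => k ->.
    by apply: funring_ext (au k j) _ => x; rewrite mxE.
  by apply: funring_ext (ad k j) _ => x; rewrite mxE.
pose F2 := [set (fun x => (\det (Q x))^-1)] `|` F1.
have sF2 : F1 `<=` F2 by right.
have aQ2 := mx_in_sub sF2 aQ.
exists F2; split=> //.
- apply: growth_adjoin_inv => //; first exact: funring_det.
  by move=> x Tx; have [_ _] := TQ x Tx; rewrite unitmxE unitfE.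
- exact: subset_trans sF2.
- apply: (mx_in_right_inverse (alg_funring T F2) (@alg_on_ext K X T F2) _ _ aQ2);
    last by apply: alg_gen; left.
  by move=> x Tx; have [_ _ uQ] := TQ x Tx; rewrite mulmxV.
Qed.

End AdjoiningQuadruples.

(** * Pivot columns of an invertible matrix *)

Section Frames.
Local Open Scope classical_set_scope.
Variable K : fieldType.

Lemma row_free_frame (A : 'M[K]_(2, 4)) : row_free A ->
  exists2 f : 'I_2 -> 'I_4, injective f & colsub f A \in unitmx.
Proof.
move=> frA; have fuA : row_full A^T by rewrite /row_full mxrank_tr.
exists (fullrankfun fuA); first exact: fullrankfun_inj.
rewrite (_ : colsub _ A = (rowsub (fullrankfun fuA) A^T)^T).
  by rewrite unitmx_tr; exact: fullrowsub_unit.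
by apply/matrixP => i j; rewrite !mxE.
Qed.

(** Both halves of an invertible matrix have rank two, so each contains an invertible 2 x 2
    submatrix; these are [A1] and [A2]. *)
Lemma frame_decomposition (P : 'M[K]_(2 + 2)) : P \in unitmx ->
  exists A1 A2 : 'M[K]_2, exists Q f g, [/\ injective f, injective g, frames f g Q,
    A1 \in unitmx /\ A2 \in unitmx & P = block_mx A1 0 0 A2 *m Q].
Proof.
move=> uP.
have fru : row_free (usubmx P).
  apply/row_freeP; exists (lsubmx (invmx P)).
  rewrite mul_usub_mx mulmx_lsub mulmxV// scalar_mx_block.
  by rewrite block_mxEh row_mxKl col_mxKu.
have frd : row_free (dsubmx P).
  apply/row_freeP; exists (rsubmx (invmx P)).
  rewrite mul_dsub_mx mulmx_rsub mulmxV// scalar_mx_block.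
  by rewrite block_mxEh row_mxKr col_mxKd.
have [f injf uA1] := row_free_frame fru.
have [g injg uA2] := row_free_frame frd.
set A1 := colsub f _ in uA1; set A2 := colsub g _ in uA2.
pose Q := col_mx (invmx A1 *m usubmx P) (invmx A2 *m dsubmx P).
have defP : P = block_mx A1 0 0 A2 *m Q.
  rewrite mul_block_col !mul0mx addr0 add0r !mulmxA !mulmxV// !mul1mx.
  by rewrite vsubmxK.
exists A1, A2, Q, f, g; split=> //; split.
- by rewrite col_mxKu -mulmx_colsub mulVmx.
- by rewrite col_mxKd -mulmx_colsub mulVmx.
- by move: uP; rewrite {1}defP unitmx_mul => /andP[].
Qed.

End Frames.

(** * Linear functionals of matrix-valued functions *)

Section LinearFunctionals.
Local Open Scope classical_set_scope.
Variables (K : fieldType) (X : Type) (A : set (X -> K)).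
Hypothesis HA : funring A.

Lemma funring_scalar_mx m n (f : {scalar 'M[K]_(m, n)}) (M : X -> 'M[K]_(m, n)) :
  mx_in A M -> A (fun x => f (M x)).
Proof.
move=> AM; have /funring_ext : A (fun x => \sum_i \sum_j M x i j * f (delta_mx i j)).
  do 2![apply: (funring_sum HA) => ? _]; apply: (funring_mul HA) => //.
  exact: (funring_cst HA).
apply=> x; rewrite [in RHS](matrix_sum_delta (M x)) linear_sum.
apply: eq_bigr => i _; rewrite linear_sum; apply: eq_bigr => j _.
by rewrite linearZ.
Qed.

Lemma funring_scalar_ffun (I : finType) m n (f : {scalar {ffun I -> 'M[K]_(m, n)}})
    (M : X -> {ffun I -> 'M[K]_(m, n)}) :
  (forall i, mx_in A (fun x => M x i)) -> A (fun x => f (M x)).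
Proof.
move=> AM; pose b i k l : {ffun I -> 'M[K]_(m, n)} :=
  [ffun i' => (i' == i)%:R *: delta_mx k l].
have /funring_ext : A (fun x => \sum_i \sum_k \sum_l M x i k l * f (b i k l)).
  do 3![apply: (funring_sum HA) => ? _]; apply: (funring_mul HA) => //.
    exact: AM.
  exact: (funring_cst HA).
apply=> x; have {2}-> : M x = \sum_i \sum_k \sum_l M x i k l *: b i k l.
  apply/ffunP => j; rewrite sum_ffunE (bigD1 j) //= [X in _ + X]big1 => [|i ij].
    rewrite addr0 [LHS]matrix_sum_delta sum_ffunE; apply: eq_bigr => k _.
    by rewrite sum_ffunE; apply: eq_bigr => l _; rewrite !ffunE eqxx scale1r.
  rewrite sum_ffunE big1 // => k _; rewrite sum_ffunE big1 // => l _.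
  by rewrite !ffunE eq_sym (negbTE ij) scale0r scaler0.
do 3![rewrite linear_sum; apply: eq_bigr => ? _].
by rewrite linearZ.
Qed.

End LinearFunctionals.

(** * Normal forms under conjugation *)

Section UpperBounds.
Local Open Scope classical_set_scope.
Variable K : fieldType.

Lemma diag_with2 (mu nu : K) (B : 'M[K]_2) :
  diag_with [:: mu; nu] B -> \tr B = mu + nu /\ \det B = mu * nu.
Proof.
rewrite /diag_with => -[_ _]; rewrite !big_cons big_nil mulr1 => chB; split.
  apply: oppr_inj; rewrite -char_poly_trace// chB /= mulrBr !mulrBl !coefB.
  by rewrite coefXM coefX coefXM coefC coefMX coefC -polyCM coefC /=; ring.
have := char_poly_det B; rewrite chB -horner_coef0 !hornerE.
by rewrite sqrrN expr1n mul1r mulrNN.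
Qed.

(** Finite functions make the set of charts a finite type, as [growth_cover] requires. *)
Definition frame_index := {p : {ffun 'I_2 -> 'I_4} * {ffun 'I_2 -> 'I_4} |
  injectiveb p.1 && injectiveb p.2}.

Lemma frame_decomposition_ffun (P : 'M[K]_(2 + 2)) : P \in unitmx ->
  exists A1 A2 : 'M[K]_2, exists Q (p : frame_index), [/\
    frames (val p).1 (val p).2 Q, A1 \in unitmx, A2 \in unitmx
    & P = block_mx A1 0 0 A2 *m Q].
Proof.
case/frame_decomposition => A1 [A2 [Q [f [g [injf injg [fQ gQ uQ] [uA1 uA2] ->]]]]].
have injfg : injectiveb (finfun f) && injectiveb (finfun g).
  by apply/andP; split; apply/injectiveP => i j; rewrite !ffunE; [exact: injf|exact: injg].
exists A1, A2, Q, (exist _ (finfun f, finfun g) injfg); split=> //; split=> //=.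
- by rewrite -fQ; apply/matrixP => i j; rewrite !mxE ffunE.
- by rewrite -gQ; apply/matrixP => i j; rewrite !mxE ffunE.
Qed.

(** The pivots are absorbed by conjugating each block separately, which preserves traces,
    determinants and the product relation of the block. *)
Lemma conj_block_diag (A1 A2 B G : 'M[K]_2) (Q : 'M[K]_(2 + 2)) :
  A1 \in unitmx -> A2 \in unitmx -> Q \in unitmx ->
  invmx (block_mx A1 0 0 A2 *m Q) *m block_mx B 0 0 G *m (block_mx A1 0 0 A2 *m Q) =
  invmx Q *m block_mx (invmx A1 *m B *m A1) 0 0 (invmx A2 *m G *m A2) *m Q.
Proof.
move=> uA1 uA2 uQ.
have uD : block_mx A1 0 0 A2 \in unitmx by rewrite unitmxE det_ublock unitrM -!unitmxE uA1.
have -> : invmx (block_mx A1 0 0 A2 *m Q) = invmx Q *m invmx (block_mx A1 0 0 A2).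
  exact: (@invrM _ (block_mx A1 0 0 A2 : 'M_4) Q).
rewrite invmx_block_diag// -!mulmxA; congr (_ *m _); rewrite !mulmxA; congr (_ *m _).
by rewrite !mulmx_block !(mul0mx, mulmx0, addr0, add0r).
Qed.

Lemma char_poly_conj n (P A : 'M[K]_n) : P \in unitmx ->
  char_poly (invmx P *m A *m P) = char_poly A.
Proof.
move=> uP; rewrite /char_poly /char_poly_mx.
have PP : map_mx polyC (invmx P) *m map_mx polyC P = 1%:M.
  by rewrite -map_mxM mulVmx// map_mx1.
have -> : 'X%:M - map_mx polyC (invmx P *m A *m P) =
    map_mx polyC (invmx P) *m ('X%:M - map_mx polyC A) *m map_mx polyC P.
  rewrite mulmxBr mulmxBl !map_mxM; congr (_ - _).
  by rewrite mul_mx_scalar -scalemxAl PP scalemx1.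
by rewrite !det_mulmx mulrAC -det_mulmx PP det1 mul1r.
Qed.

Lemma conj_class_diag (mu nu : K) (M : 'M[K]_4) : conj_class mu nu M ->
  exists2 P : 'M[K]_(2 + 2), P \in unitmx &
    M = invmx P *m block_mx mu%:M 0 0 nu%:M *m P.
Proof.
case=> uM [P uP] /(similar_diagLR uP)[D].
rewrite conjumx ?unitmx_inv// invmxK => defM chM.
pose t : 4.-tuple K := [tuple mu; mu; nu; nu].
(* Factoring the characteristic polynomial gives the diagonal entries only up to order; the
   permutation [s] sorts them. *)
have : perm_eq [seq D 0 i | i <- enum 'I_4] t.
  apply: prod_XsubC_eq; rewrite -[RHS]chM defM char_poly_conj//.
  rewrite char_poly_trig ?is_diag_mx_is_trig ?diag_mx_is_diag// big_map big_enum /=.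
  by apply: eq_bigr => i _; rewrite mxE eqxx.
case/tuple_permP => s defs.
have Dt i : D 0 i = tnth t (s i).
  have := congr1 (fun s => nth 0 s i) defs.
  by rewrite (nth_map i) ?size_enum_ord// nth_ord_enum (nth_map i) ?size_enum_ord// nth_ord_enum.
pose E : 'M[K]_4 := block_mx (mu%:M : 'M_2) 0 0 (nu%:M : 'M_2).
have defE : E = diag_mx (\row_i tnth t i).
  have tl (k : 'I_2) : tnth t (lshift 2 k) = mu by move: k; apply: ord2P.
  have tr (k : 'I_2) : tnth t (rshift 2 k) = nu by move: k; apply: ord2P.
  apply/(@matrixP _ (2 + 2) (2 + 2)) => i j; rewrite /E [in RHS]mxE [(\row_k _) _ _]mxE.
  case: (@split_ordP 2 2 i) => k ->; case: (@split_ordP 2 2 j) => l ->.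
  - by rewrite block_mxEul mxE tl.
  - by rewrite block_mxEur mxE -val_eqE /= ltn_eqF ?mulr0n// (leq_trans (ltn_ord k))// leq_addr.
  - by rewrite block_mxEdl mxE -val_eqE /= gtn_eqF ?mulr0n// (leq_trans (ltn_ord l))// leq_addr.
  - by rewrite block_mxEdr mxE tr; congr (_ *+ nat_of_bool _); rewrite -!val_eqE /= eqn_add2l.
have uS : perm_mx s \in @unitmx K 4 := unitmx_perm _ s.
have sE : perm_mx s *m E = diag_mx D *m perm_mx s.
  apply/matrixP => i j; rewrite -row_permE defE mul_diag_mx !mxE Dt.
  by rewrite -mulr_natr; congr (_ * _).
exists (invmx (perm_mx s) *m P); first by rewrite unitmx_mul unitmx_inv uS.
have -> : invmx (invmx (perm_mx s) *m P) = invmx P *m perm_mx s.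
  by have := @invrM _ (invmx (perm_mx s) : 'M[K]_4) P; rewrite invrK; apply=> //; rewrite unitmx_inv.
rewrite -/E defM -!mulmxA; congr (_ *m _); rewrite !mulmxA sE; congr (_ *m _).
by rewrite -mulmxA mulmxV// mulmx1.
Qed.
End UpperBounds.

(** * Upper bounds for conjugacy classes and for N *)

Section GrowthOfVarieties.
Local Open Scope classical_set_scope.
Variable K : fieldType.

Lemma growth_conj_class (mu nu : K) : growth (conj_class mu nu) (@coords K 'M[K]_4) 8.
Proof.
pose E : 'M[K]_(2 + 2) := block_mx mu%:M 0 0 nu%:M.
pose U (p : frame_index) : set 'M[K]_4 := [set M | exists2 Q : 'M[K]_(2 + 2),
  frames (val p).1 (val p).2 Q & M = invmx Q *m E *m Q].
apply: (growth_cover (U := U)) => [[[f g] /= injfg]|M]; last first.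
  case/conj_class_diag => P uP ->.
  have [A1 [A2 [Q [p [pQ uA1 uA2 ->]]]]] := frame_decomposition_ffun uP.
  exists p, Q => //; have [_ _ uQ] := pQ.
  (* The blocks are scalar, so conjugation by [A1] and [A2] leaves them unchanged. *)
  rewrite conj_block_diag// -![_ *m _%:M *m _]mulmxA !mul_scalar_mx.
  by rewrite -!scalemxAr !mulVmx// !scalemx1.
have /andP[/injectiveP injf /injectiveP injg] := injfg.
have [F [gF _ aQ aV]] := growth_adjoin_frame (T := [set Q | frames f g Q]) (Q := @id 'M[K]_(2 + 2)) injf injg
  (growth_empty K _) (fun _ => id).
have AF := @alg_funring K _ [set Q | frames f g Q] F.
apply: (growth_pull (r := fun j Q => coord (vbasis {:'M[K]_4}) j (invmx Q *m E *m Q)) gF).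
  move=> j; apply: (@funring_scalar_mx K _ _ AF 4 4 (coord _ j)).
  by do 2![apply: (mx_in_mul AF) => //]; exact: mx_in_cst.
by move=> M [Q fQ ->]; exists Q.
Qed.

(** These polynomial consequences of [diag_with] survive conjugation and suffice for counting
    parameters. *)
Definition local_system (mu nu : 'I_4 -> K) (B : 'I_4 -> 'M[K]_2) :=
  (forall j, \tr (B j) = mu j + nu j /\ \det (B j) = mu j * nu j) /\
  \prod_(j < 4) B j = 1.

Lemma prod_conj n (B : 'I_4 -> 'M[K]_n.+1) (A : 'M[K]_n.+1) : A \in unitmx ->
  \prod_(j < 4) (invmx A *m B j *m A) = invmx A *m (\prod_(j < 4) B j) *m A.
Proof.
move=> uA; rewrite !prod_ord4 -!mulmxE !mulmxA.
by rewrite !(mulmxKV, mulmxK).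
Qed.

Lemma local_system_conj mu nu B A : A \in unitmx -> local_system mu nu B ->
  local_system mu nu (fun j => invmx A *m B j *m A).
Proof.
move=> uA [Btd Bprod]; split=> [j|].
  have [<- <-] := Btd j; split.
    by rewrite mxtrace_mulC mulmxA mulmxV// mul1mx.
  by rewrite !det_mulmx mulrAC -det_mulmx mulVmx// det1 mul1r.
by rewrite prod_conj// Bprod mulmx1 mulVmx.
Qed.

Lemma growth_varN (mu nu : 'I_4 -> K) :
  (forall j, mu j != 0) -> (forall j, nu j != 0) ->
  growth (varN mu nu) (@coords K {ffun 'I_4 -> 'M[K]_4}) 18.
Proof.
move=> mu0 nu0.
pose X := ('M[K]_(2 + 2) * (('I_4 -> 'M[K]_2) * ('I_4 -> 'M[K]_2)))%type.
pose phi (x : X) : {ffun 'I_4 -> 'M[K]_4} :=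
  [ffun j => invmx x.1 *m block_quadruple x.2.1 x.2.2 j *m x.1].
pose T (q : frame_index * ('I_3 * 'I_3)) : set X := [set x |
  [/\ frames (val q.1).1 (val q.1).2 x.1,
      local_system mu nu x.2.1 /\ chart q.2.1 (x.2.1 0 *m x.2.1 1)
    & local_system mu nu x.2.2 /\ chart q.2.2 (x.2.2 0 *m x.2.2 1)]].
apply: (growth_cover (U := fun q => [set M | exists2 x, T q x & M = phi x])).
  case=> [[[f g] /= injfg] [c c']].
  have /andP[/injectiveP injf /injectiveP injg] := injfg.
  set q := (_, _).
  have d0 j : mu j * nu j != 0 by rewrite mulf_neq0.
  have [|F1 [gF1 _ aQ aV]] := growth_adjoin_frame (T := T q) (Q := fun x : X => x.1)
    injf injg (growth_empty K (T q)).
    by move=> x [].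
  have [|||F2 [gF2 sF2 aB]] := growth_adjoin_quadruple (T := T q) (c := c)
    (B := fun x : X => x.2.1) (t := fun j => mu j + nu j) gF1 d0.
  - by move=> x [_ [[]]].
  - by move=> x [_ [[]]].
  - by move=> x [_ []].
  have [|||F3 [gF3 sF3 aG]] := growth_adjoin_quadruple (T := T q) (c := c')
    (B := fun x : X => x.2.2) (t := fun j => mu j + nu j) gF2 d0.
  - by move=> x [_ _ [[]]].
  - by move=> x [_ _ [[]]].
  - by move=> x [_ _ []].
  have AF := @alg_funring K X (T q) F3.
  have sF13 := subset_trans sF2 sF3.
  apply: (growth_pull (r := fun j x => coord (vbasis {:{ffun 'I_4 -> 'M[K]_4}}) j (phi x)) gF3).
    move=> j; apply: (@funring_scalar_ffun K _ _ AF 'I_4 4 4 (coord _ j)) => k k1 k2.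
    have : mx_in (alg (T q) F3) (fun x => invmx x.1 *m block_quadruple x.2.1 x.2.2 k *m x.1).
      apply: (mx_in_mul AF); last exact: mx_in_sub sF13 _.
      apply: (mx_in_mul AF); first exact: mx_in_sub sF13 _.
      apply: (@mx_in_block K X _ 2 2 2 2).
      + exact: mx_in_sub sF3 _.
      + exact: mx_in_cst.
      + exact: mx_in_cst.
      + exact: aG.
    by move=> /(_ k1 k2)/funring_ext; apply=> x; rewrite ffunE.
  by move=> M [x Tx ->]; exists x.
move=> M [_ _ [B [G [[P uP MP] BGd prodB prodG _]]]].
have [A1 [A2 [Q [p [pQ uA1 uA2 defP]]]]] := frame_decomposition_ffun uP.
have lsB : local_system mu nu B by split=> // j; have [/diag_with2] := BGd j.
have lsG : local_system mu nu G by split=> // j; have [_ /diag_with2] := BGd j.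
pose B' j := invmx A1 *m B j *m A1; pose G' j := invmx A2 *m G j *m A2.
(* Charts depend on matrix entries and not only on conjugacy classes, so they are chosen after [A1]
   and [A2] have been absorbed. *)
have [c cB] := chartP (B' 0 *m B' 1); have [c' cG] := chartP (G' 0 *m G' 1).
exists (p, (c, c')), (Q, (B', G')).
  by split=> //; split=> //; exact: local_system_conj.
apply/ffunP => j; rewrite ffunE MP defP /block_quadruple conj_block_diag//.
by have [_ _ uQ] := pQ.
Qed.

End GrowthOfVarieties.

(** * Irreducible families and the lower bounds *)

Section RationalCurves.
Local Open Scope classical_set_scope.
Variable K : numFieldType.

Lemma poly_nonroot (p : {poly K}) : p != 0 -> exists t, p.[t] != 0.
Proof.
move=> p0; apply: contrapT => /forallNP noroot.
have := max_poly_roots (rs := [seq i%:R | i <- iota 0 (size p)]) p0.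
rewrite size_map size_iota ltnn => H; suff : false by []; apply: H.
  by apply/allP => t _; apply/negPn/negP => pt; apply: (noroot t).
rewrite map_inj_uniq ?iota_uniq// => i j /eqP.
by rewrite Num.Theory.eqr_nat => /eqP.
Qed.

Definition polyfun (g : K -> K) := exists p : {poly K}, forall t, g t = p.[t].

Lemma polyfun_funring : funring polyfun.
Proof.
split=> [c|f g [p pf] [q qg]|f g [p pf] [q qg]].
- by exists c%:P => t; rewrite hornerC.
- by exists (p + q) => t; rewrite hornerD pf qg.
- by exists (p * q) => t; rewrite hornerM pf qg.
Qed.

Definition ratfun (U : set K) (g : K -> K) :=
  exists p q : {poly K}, forall t, U t -> q.[t] != 0 /\ g t = p.[t] / q.[t].

Lemma ratfun_on U f g : ratfun U f -> (forall t, U t -> f t = g t) -> ratfun U g.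
Proof. by move=> [p [q pq]] fg; exists p, q => t Ut; rewrite -fg//; exact: pq. Qed.

Lemma ratfun_funring U : funring (ratfun U).
Proof.
split=> [c|f g [p [q pq]] [p' [q' pq']]|f g [p [q pq]] [p' [q' pq']]].
- by exists c%:P, 1 => t _; rewrite !hornerE oner_neq0 divr1.
- exists (p * q' + p' * q), (q * q') => t Ut; rewrite !hornerE.
  have [q0 ->] := pq t Ut; have [q'0 ->] := pq' t Ut.
  by rewrite mulf_neq0//; split=> //; field; rewrite q0 q'0.
- exists (p * p'), (q * q') => t Ut; rewrite !hornerE.
  have [q0 ->] := pq t Ut; have [q'0 ->] := pq' t Ut.
  by rewrite mulf_neq0//; split=> //; field; rewrite q0 q'0.
Qed.

Lemma ratfun_poly U g : polyfun g -> ratfun U g.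
Proof. by move=> [p pg]; exists p, 1 => t _; rewrite hornerC oner_neq0 divr1. Qed.

Lemma ratfun_inv U g : ratfun U g -> (forall t, U t -> g t != 0) -> ratfun U (fun t => (g t)^-1).
Proof.
move=> [p [q pq]] g0; exists q, p => t Ut; have [q0 gt] := pq t Ut.
have := g0 t Ut; rewrite gt mulf_eq0 negb_or => /andP[p0 _].
by rewrite p0 invf_div.
Qed.

Lemma mx_in_ratfun_inv U n (M : K -> 'M[K]_n) :
  mx_in (ratfun U) M -> (forall t, U t -> M t \in unitmx) ->
  mx_in (ratfun U) (fun t => invmx (M t)).
Proof.
move=> rM uM; apply: (mx_in_right_inverse (ratfun_funring U) (@ratfun_on U) _ _ rM).
  by move=> t /uM; exact: mulmxV.
apply: ratfun_inv; first by apply: funring_det rM; exact: ratfun_funring.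
by move=> t /uM; rewrite unitmxE unitfE.
Qed.

Definition line (E : lmodType K) (a b : E) (t : K) : E := a + t *: (b - a).

Lemma line0 (E : lmodType K) (a b : E) : line a b 0 = a.
Proof. by rewrite /line scale0r addr0. Qed.

Lemma line1 (E : lmodType K) (a b : E) : line a b 1 = b.
Proof. by rewrite /line scale1r addrC subrK. Qed.

Lemma mx_in_line m n (a b : 'M[K]_(m, n)) : mx_in polyfun (line a b).
Proof.
move=> i j; exists ((a i j)%:P + 'X * (b i j - a i j)%:P) => t.
by rewrite !hornerE !mxE.
Qed.

(* Two points of W lie on a line that meets W in a nonempty Zariski open subset,
   so on the image of W a product of regular functions vanishes only if a factor does. *)
Lemma integral_image (V : vectType K) (E : lmodType K) (W : set E) (phi : E -> V) :
  (forall a b, W a -> W b -> exists2 D, polyfun D &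
     forall t, D t != 0 <-> W (line a b t)) ->
  (forall a b, W a -> W b -> forall i,
     ratfun (W \o line a b) (fun t => coord (vbasis {:V}) i (phi (line a b t)))) ->
  integral_on (phi @` W).
Proof.
move=> WD Wphi f g rf rg fg0; apply: contrapT => /not_orP[].
move=> /existsNP[_ /not_implyP[[a Wa <-] fa]] /existsNP[_ /not_implyP[[b Wb <-] gb]].
have [D [d dD] DW] := WD a b Wa Wb.
have rc h : regular h -> ratfun (W \o line a b) (fun t => h (phi (line a b t))).
  move=> rh; apply: (regular_comp (phi := fun t => phi (line a b t))) rh => [|i].
    exact: ratfun_funring.
  exact: Wphi.
have [p [q pq]] := rc f rf; have [p' [q' pq']] := rc g rg.
have W0 : (W \o line a b) 0 by rewrite /= line0.
have W1 : (W \o line a b) 1 by rewrite /= line1.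
(* [d] and [p] are nonzero at the parameter 0 of [a], and [p'] at the parameter 1 of [b]. A common
   nonroot gives a point of [W] at which neither [f] nor [g] vanishes. *)
have /poly_nonroot[t] : d * p * p' != 0.
  rewrite !mulf_neq0//.
  - by apply/eqP => d0; have := (DW 0).2 W0; rewrite dD d0 horner0 eqxx.
  - by apply/eqP => p0; apply: fa; rewrite -(line0 a b) (pq 0 W0).2 p0 horner0 mul0r.
  - by apply/eqP => p0; apply: gb; rewrite -(line1 a b) (pq' 1 W1).2 p0 horner0 mul0r.
rewrite !hornerM !mulf_eq0 !negb_or => /andP[/andP[dt pt] p't].
have Wt : W (line a b t) by apply/DW; rewrite dD.
have [qt ft] := pq t Wt; have [q't gt] := pq' t Wt.
have /eqP := fg0 _ (imageP _ Wt); rewrite ft gt !mulf_eq0 !invr_eq0.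
by rewrite (negbTE pt) (negbTE p't) (negbTE qt) (negbTE q't).
Qed.

End RationalCurves.

(** * Determinantal separating functions *)

Section Separators.
Local Open Scope classical_set_scope.
Variables (K : fieldType) (V : vectType K).

(** Let [N] be a right inverse of [L w]. Then [\det (L v *m N)] is 1 at [w], and it vanishes
    wherever the row rank of [L v] drops. *)
Lemma rank_separator m n (L : V -> 'M[K]_(m, n)) w :
  mx_in (@regular K V) L -> row_free (L w) ->
  exists h, [/\ regular h, h w != 0 & forall v, ~~ row_free (L v) -> h v = 0].
Proof.
move=> rL /row_freeP[N LN]; have RF := @regular_funring K V.
exists (fun v => \det (L v *m N)); split=> [||v].
- by apply: (funring_det RF); apply: (mx_in_mul RF) => //; exact: mx_in_cst.
- by rewrite LN det1 oner_neq0.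
apply: contraNeq; rewrite -unitfE -unitmxE => uLN; apply/row_freeP.
by exists (N *m invmx (L v *m N)); rewrite mulmxA mulmxV.
Qed.

(** Outside [A] the matrix looks like a scalar one. Leaving the scalar [Q k k] variable makes the
    conditions linear and homogeneous, with the identity as a solution. *)
Definition pinned n (A : pred ('I_n * 'I_n)) (k : 'I_n) (Q : 'M[K]_n) :=
  forall i j, ~~ A (i, j) -> Q i j = (i == j)%:R * Q k k.

(* The existence of a nonzero Q in a linear space of matrices such that
   Q *m v j = M0 j *m Q is a determinantal condition on v. *)
Lemma conj_separator (J : finType) n (comp : V -> J -> 'M[K]_n) (M0 : J -> 'M[K]_n)
    (A : pred ('I_n * 'I_n)) k w :
  (forall j, mx_in (@regular K V) (comp^~ j)) ->
  (forall Q, pinned A k Q -> (forall j, Q *m comp w j = M0 j *m Q) -> Q = 0) ->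
  exists h, [/\ regular h, h w != 0 & forall v Q, Q != 0 -> pinned A k Q ->
    (forall j, Q *m comp v j = M0 j *m Q) -> h v = 0].
Proof.
move=> rcomp Q0; have RF := @regular_funring K V.
pose C : finType := (J * ('I_n * 'I_n) + 'I_n * 'I_n)%type.
pose lam v (Q : 'M[K]_n) (c : C) : K := match c with
  | inl p => (Q *m comp v p.1 - M0 p.1 *m Q) p.2.1 p.2.2
  | inr p => if A p then 0 else Q p.1 p.2 - (p.1 == p.2)%:R * Q k k end.
(* [L v] is the matrix of the linear system for [Q] written as a row vector: a nonzero solution
   exists exactly when [L v] is not row free. *)
pose L v : 'M[K]_(n * n, #|C|) :=
  \matrix_(r, c) lam v (vec_mx (delta_mx 0 r)) (enum_val c).
have lamE v u c : (u *m L v) 0 c = lam v (vec_mx u) (enum_val c).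
  rewrite mxE {2}(row_sum_delta u) linear_sum.
  under eq_bigr => r _ do rewrite mxE.
  case: (enum_val c) => [[j [p q]]|[p q]] /=.
    rewrite mulmx_suml mulmx_sumr -sumrB summxE; apply: eq_bigr => r _.
    by rewrite linearZ -scalemxAl -scalemxAr -scalerBr [RHS]mxE.
  case: ifP => _; first by rewrite big1// => r _; rewrite mulr0.
  rewrite !summxE mulr_sumr -sumrB; apply: eq_bigr => r _.
  by rewrite linearZ /= !mxE mulrBr; congr (_ - _); rewrite mulrCA.
have kerP v Q : (forall c, lam v Q c = 0) <->
    pinned A k Q /\ (forall j, Q *m comp v j = M0 j *m Q).
  split=> [l0|[pQ cQ] [[j [p q]]|[p q]] /=].
  - split=> [p q nA|j].
      by have /eqP := l0 (inr (p, q)); rewrite /= (negbTE nA) subr_eq0 => /eqP.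
    apply/eqP; rewrite -subr_eq0; apply/eqP/matrixP => p q.
    by rewrite [RHS]mxE; exact: l0 (inl (j, (p, q))).
  - by rewrite cQ subrr mxE.
  - by case: ifPn => // /pQ->; rewrite subrr.
have rL : mx_in (@regular K V) L.
  move=> r c; have /funring_ext : regular (fun v => lam v (vec_mx (delta_mx 0 r)) (enum_val c)).
    case: (enum_val c) => [[j [p q]]|[p q]]; last exact: (funring_cst RF).
    have [r1 r2] : mx_in (@regular K V) (fun v => vec_mx (delta_mx 0 r) *m comp v j)
        /\ mx_in (@regular K V) (fun v => - (M0 j *m vec_mx (delta_mx 0 r))).
      by split; [apply: (mx_in_mul RF) => //|]; exact: mx_in_cst.
    exact: (mx_in_add RF r1 r2 p q).
  by apply=> v; rewrite mxE.
have freew : row_free (L w).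
  rewrite -kermx_eq0; apply/eqP; apply: contrapT => /eqP/rowV0Pn[u /sub_kermxP uL /negP[]].
  apply/eqP; rewrite -[u]vec_mxK (Q0 (vec_mx u)) ?linear0//.
    by apply/((kerP w _).1 _).1 => c; rewrite -(enum_rankK c) -lamE uL mxE.
  by apply/((kerP w _).1 _).2 => c; rewrite -(enum_rankK c) -lamE uL mxE.
have [h [rh hw hL]] := rank_separator rL freew.
exists h; split=> // v Q nzQ pQ cQ; apply: hL.
rewrite -kermx_eq0; apply/rowV0Pn; exists (mxvec Q); last first.
  by apply: contraNneq nzQ => Q0'; rewrite -(mxvecK Q) Q0' linear0.
apply/sub_kermxP/rowP => c; rewrite lamE mxvecK [RHS]mxE.
by apply/(kerP v Q).2.
Qed.

End Separators.

(** * Strict steps along a conjugation orbit *)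

Section OrbitChains.
Local Open Scope classical_set_scope.
Variables (K : numFieldType) (n : nat).

(** [delta_mx p q] is idempotent for [p = q] and has square zero otherwise, whence the factor 1/2 or
    1 in the inverse. *)
Lemma unitmx_add_delta (p q : 'I_n.+1) : 1%:M + delta_mx p q \in @unitmx K n.+1.
Proof.
pose c : K := if p == q then 2%:R^-1 else 1.
suff /mulmx1_unit[] : (1%:M + delta_mx p q) *m (1%:M - c *: delta_mx p q) = 1%:M by [].
rewrite mulmxDl mul1mx mulmxBr mulmx1 -scalemxAr mul_delta_mx_cond.
rewrite -scaler_nat scalerA -[RHS]addr0 -[LHS]addrA; congr (_ + _).
rewrite -[X in _ + (X - _)]scale1r -scalerBl -scaleNr -scalerDl.
rewrite [X in X *: _](_ : _ = 0) ?scale0r// /c [q == p]eq_sym; case: eqP => _ /=.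
  by rewrite mulr1; field.
by rewrite mulr0 subr0 addNr.
Qed.

Variables (V : vectType K) (J : finType) (comp : V -> J -> 'M[K]_n.+1).
Variables (M0 : J -> 'M[K]_n.+1) (s : seq ('I_n.+1 * 'I_n.+1)).
Hypotheses (rcomp : forall j, mx_in (@regular K V) (comp^~ j)).
Hypotheses (uniqs : uniq s) (s00 : (0, 0) \notin s).
Hypothesis (cent : forall p C, p \in s -> (forall j, C *m M0 j = M0 j *m C) ->
  pinned (mem s) 0 (C *m (1%:M + delta_mx p.1 p.2)) -> exists a, C = a%:M).

Lemma pinned_take k (Q : 'M[K]_n.+1) :
  pinned (mem (take k s)) 0 Q -> pinned (mem (take k.+1 s)) 0 Q.
Proof.
move=> pQ i j nij; apply: pQ; apply: contra nij.
by rewrite -{1}(@take_takel _ k k.+1)//; exact: mem_take.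
Qed.

Lemma pinned_add_delta k : (k < size s)%N ->
  pinned (mem (take k.+1 s)) 0
    (1%:M + delta_mx (nth (0, 0) s k).1 (nth (0, 0) s k).2 : 'M[K]_n.+1).
Proof.
move=> ltk; have ps : nth (0, 0) s k \in take k.+1 s.
  by rewrite (take_nth (0, 0))// mem_rcons mem_head.
have := memPn s00 _ (mem_nth (0, 0) ltk).
case: (nth _ s k) ps => p q /= ps pq0 i j nij; rewrite !mxE eqxx.
rewrite [(i == p) && _](_ : _ = false); last first.
  by apply: contraNF nij => /andP[/eqP-> /eqP->].
rewrite [(0 == p) && _](_ : _ = false) ?addr0 ?mulr1//.
by apply: contraNF pq0 => /andP[/eqP<- /eqP<-].
Qed.

(** If [Q] also carries [comp w] to [M0], then [C = Q *m invmx P] centralizes [M0] and [C *m P] is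
    pinned, so [cent] gives [Q = a *: P]. The k-th position of [s] is still frozen for [Q], but
    there [P] differs from a scalar matrix; hence [a = 0]. *)
Lemma orbit_separator k w : (k < size s)%N ->
  let P := 1%:M + delta_mx (nth (0, 0) s k).1 (nth (0, 0) s k).2 in
  (forall j, P *m comp w j = M0 j *m P) ->
  exists h, [/\ regular h, h w != 0 & forall v Q, Q != 0 -> pinned (mem (take k s)) 0 Q ->
    (forall j, Q *m comp v j = M0 j *m Q) -> h v = 0].
Proof.
move=> ltk P wP; have uP : P \in unitmx by exact: unitmx_add_delta.
apply: conj_separator => // Q pQ wQ.
have ps := mem_nth (0, 0) ltk.
have nps : nth (0, 0) s k \notin take k s.
  have := take_uniq k.+1 uniqs; rewrite (take_nth (0, 0))// rcons_uniq => /andP[].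
  by [].
have [|||a defC] := cent (p := nth (0, 0) s k) (C := Q *m invmx P).
- by [].
- move=> j; apply: (can_inj (mulmxK uP)); rewrite -!mulmxA mulVmx// mulmx1.
  by rewrite -wP (mulmxA (invmx P)) mulVmx// mul1mx wQ.
- rewrite mulmxKV// => i j nij; apply: pQ; apply: contra nij; exact: mem_take.
have defQ : Q = a *: P by rewrite -[LHS](mulmxKV uP) defC mul_scalar_mx.
suff a0 : a = 0 by rewrite defQ a0 scale0r.
have := pQ (nth (0, 0) s k).1 (nth (0, 0) s k).2; rewrite -surjective_pairing => /(_ nps).
have := pinned_add_delta ltk; rewrite -/P.
have := memPn s00 _ ps.
rewrite defQ /P; case: (nth _ s k) => p q pq0 _ /=; rewrite !mxE !eqxx /=.
rewrite [(0 == p) && _](_ : _ = false) ?addr0; last first.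
  by apply: contraNF pq0 => /andP[/eqP<- /eqP<-].
by rewrite !mulr1n !mulr1 mulrDr mulr1 mulrC => /eqP; rewrite -subr_eq0 addrAC subrr add0r => /eqP.
Qed.

End OrbitChains.

(** * Dimension of the conjugacy classes *)

Section ConjugacyClasses.
Local Open Scope classical_set_scope.
Variable K : numFieldType.

Lemma char_poly_block_diag m n (A : 'M[K]_m) (B : 'M[K]_n) :
  char_poly (block_mx A 0 0 B) = char_poly A * char_poly B.
Proof.
rewrite /char_poly /char_poly_mx map_block_mx !map_mx0 scalar_mx_block.
by rewrite opp_block_mx add_block_mx !subr0 det_ublock.
Qed.

Lemma char_poly_scalar n (a : K) : char_poly (a%:M : 'M_n) = ('X - a%:P) ^+ n.
Proof. by rewrite /char_poly /char_poly_mx map_scalar_mx -raddfB det_scalar. Qed.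

(** [(X - mu)(X - nu)] annihilates [A] and has distinct roots, which gives diagonalizability;
    multiplicities come from the characteristic polynomial. *)
Lemma diag_withI n (mu nu : K) (s : seq K) (A P : 'M[K]_n.+1) : mu != nu ->
  all (predC1 0) s -> P \in unitmx ->
  char_poly A = \prod_(a <- s) ('X - a%:P) ->
  (A - mu%:M) *m (A - nu%:M) = 0 ->
  diag_with s (invmx P *m A *m P).
Proof.
move=> munu s0 uP chA A0; have chM := char_poly_conj A uP; split.
- rewrite unitmxE unitfE; have := char_poly_det (invmx P *m A *m P).
  rewrite chM chA -horner_coef0 horner_prod => dM.
  apply: contraTneq isT => d0; have /eqP := dM; rewrite d0 mulr0.
  rewrite prodf_seq_eq0 => /hasP[a sa]; rewrite !hornerE oppr_eq0 => /eqP a0.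
  by have := allP s0 a sa; rewrite /= a0 eqxx.
- apply/diagonalizableP; exists [:: mu; nu]; first by rewrite /= inE munu.
  rewrite dvd_mxminpoly !big_cons big_nil mulr1 rmorphM /= !rmorphB /=.
  rewrite horner_mx_X !horner_mx_C.
  have conjB a : invmx P *m A *m P - a%:M = invmx P *m (A - a%:M) *m P.
    rewrite mulmxBr mulmxBl; congr (_ - _).
    by rewrite mul_mx_scalar -scalemxAl mulVmx// scalemx1.
  rewrite !conjB -mulmxE !mulmxA mulmxK// -[_ *m _ *m (A - _)]mulmxA A0.
  by rewrite mulmx0 mul0mx.
- by rewrite chM.
Qed.

Lemma regular_linear (V : vectType K) (f : V -> K) : scalar f -> regular f.
Proof.
move=> lin_f; pose g : {scalar V} := HB.pack f (GRing.isLinear.Build _ _ _ _ f lin_f).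
exact: (regular_scalar g).
Qed.

(** For [mu != nu] the entries of the two off-diagonal blocks span a complement to the centralizer
    of [eigenblocks], so their number 8 is the dimension of the orbit. *)
Definition offdiag : seq ('I_4 * 'I_4) :=
  filter (fun p : 'I_4 * 'I_4 => (p.1 < 2)%N != (p.2 < 2)%N) (enum {: 'I_4 * 'I_4}).

Lemma mem_offdiag p : (p \in offdiag) = ((p.1 < 2)%N != (p.2 < 2)%N).
Proof. by rewrite mem_filter mem_enum andbT. Qed.

Lemma size_filter_pairs (P : pred ('I_4 * 'I_4)) :
  size [seq p <- enum {: 'I_4 * 'I_4} | P p] = (\sum_i \sum_j P (i, j))%N.
Proof.
rewrite size_filter -sum1_count big_enum_cond pair_big /= big_mkcond /=.
by apply: eq_bigr => -[i j] _; case: (P _).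
Qed.

Lemma size_offdiag : size offdiag = 8.
Proof. by rewrite size_filter_pairs !big_ord_recl !big_ord0. Qed.

Lemma pinned_line n (A : pred ('I_n * 'I_n)) k (a b : 'M[K]_n) t :
  pinned A k a -> pinned A k b -> pinned A k (line a b t).
Proof. by move=> pa pb i j nij; rewrite !mxE pa// pb//; ring. Qed.

Lemma pinned1 n (A : pred ('I_n * 'I_n)) k : pinned A k (1%:M : 'M[K]_n).
Proof. by move=> i j _; rewrite !mxE eqxx mulr1. Qed.

Definition eigenblocks (mu nu : K) : 'M[K]_(2 + 2) := block_mx mu%:M 0 0 nu%:M.

Lemma conj_class_eigenblocks mu nu (P : 'M[K]_4) : mu != nu -> mu != 0 -> nu != 0 ->
  P \in unitmx -> conj_class mu nu (invmx P *m eigenblocks mu nu *m P).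
Proof.
move=> munu mu0 nu0 uP; apply: (@diag_withI 3 mu nu) => //=.
- by rewrite mu0 nu0.
- rewrite [LHS](char_poly_block_diag (mu%:M : 'M_2) (nu%:M : 'M_2)).
  by rewrite !char_poly_scalar !big_cons big_nil !expr2 mulr1 mulrA.
- suff : (eigenblocks mu nu - mu%:M) *m (eigenblocks mu nu - nu%:M) = 0 by [].
  rewrite /eigenblocks !(@scalar_mx_block _ 2 2) !opp_block_mx !add_block_mx.
  rewrite (@mulmx_block _ 2 2 2 2 2 2).
  by rewrite !(subrr, oppr0, add0r, mul0mx, mulmx0, addr0) block_mx0.
Qed.

Lemma eigenblocksE mu nu (i j : 'I_4) :
  eigenblocks mu nu i j = (if (i < 2)%N then mu else nu) *+ (i == j).
Proof.
rewrite /eigenblocks; case: (@split_ordP 2 2 i) => k ->; case: (@split_ordP 2 2 j) => l ->.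
- by rewrite block_mxEul mxE .
- by rewrite block_mxEur mxE -val_eqE /= ltn_eqF ?mulr0n// (leq_trans (ltn_ord k))// leq_addr.
- by rewrite block_mxEdl mxE -val_eqE /= gtn_eqF ?mulr0n// (leq_trans (ltn_ord l))// leq_addr.
- by rewrite block_mxEdr mxE -[in RHS]val_eqE /= eqn_add2l.
Qed.

Lemma zchain_conj_class (mu nu : K) : mu != nu -> mu != 0 -> nu != 0 ->
  exists Z, zchain (conj_class mu nu) 8 Z.
Proof.
move=> munu mu0 nu0; pose E : 'M[K]_4 := eigenblocks mu nu.
pose W k : set 'M[K]_4 := [set P | pinned (mem (take k offdiag)) 0 P /\ \det P != 0].
pose phi (P : 'M[K]_4) := invmx P *m E *m P.
have uW k P : W k P -> P \in unitmx by case=> _; rewrite unitmxE unitfE.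
(* A matrix commuting with [E] has zero off-diagonal blocks. The factor [1%:M + delta_mx] with [p]
   off-diagonal does not alter its diagonal blocks, and pinning makes them one scalar. *)
have cent p (C : 'M[K]_4) : p \in offdiag -> (forall j : unit, C *m E = E *m C) ->
    pinned (mem offdiag) 0 (C *m (1%:M + delta_mx p.1 p.2)) -> exists a, C = a%:M.
  move=> ps /(_ tt) CE pC; exists (C 0 0).
  have C0 i j : (i, j) \in offdiag -> C i j = 0.
    rewrite mem_offdiag /= => ij; have := congr1 (fun M : 'M_4 => M i j) CE.
    have -> : (C *m E) i j = C i j * E j j.
      rewrite mxE (bigD1 j)//= big1 ?addr0// => k kj.
      by rewrite eigenblocksE (negbTE kj) mulr0.
    have -> : (E *m C) i j = E i i * C i j.
      rewrite mxE (bigD1 i)//= big1 ?addr0// => k ki.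
      by rewrite eigenblocksE eq_sym (negbTE ki) mul0r.
    rewrite !eigenblocksE !eqxx !mulr1n mulrC => /eqP; rewrite -subr_eq0 -mulrBl mulf_eq0.
    case/orP => [|/eqP//]; rewrite subr_eq0.
    by move: ij; do 2!case: (_ < 2)%N => //=; rewrite ?[nu == mu]eq_sym (negbTE munu).
  have CE' i j : (i, j) \notin offdiag -> (C *m (1%:M + delta_mx p.1 p.2)) i j = C i j.
    move=> nij; rewrite mulmxDr mulmx1 mxE [X in _ + X]mxE (bigD1 p.1)//= big1 ?addr0.
      rewrite mxE eqxx /=; case: eqP => [jp|]; last by rewrite mulr0 addr0.
      rewrite (C0 i p.1) ?mul0r ?addr0//; move: nij ps; rewrite !mem_offdiag /= -jp.
      by do 3!case: (_ < 2)%N.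
    by move=> k kp; rewrite mxE (negbTE kp) mulr0.
  apply/matrixP => i j; rewrite mxE; have [ij|nij] := boolP ((i, j) \in offdiag).
    rewrite C0//; move: ij; rewrite mem_offdiag /=.
    by have [->|] := eqVneq i j; rewrite ?eqxx ?mulr0n.
  rewrite -CE'// pC// CE'; last by rewrite mem_offdiag.
  by rewrite mulr_natl.
have pinT := @pinned_take K 3 offdiag.
apply: (@zchain_of_images _ _ _ _ (fun k => phi @` W k)) => k lek.
  split.
  - move=> _ [P WP <-]; apply: conj_class_eigenblocks => //; exact: uW WP.
  - by exists (phi 1%:M); exists 1%:M => //; split; [exact: pinned1|rewrite det1 oner_neq0].
  apply: integral_image => a b Wa Wb.
    exists (fun t => \det (line a b t)).
      by apply: (funring_det (polyfun_funring K)); exact: mx_in_line.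
    move=> t; split=> [dt|[]//]; split=> //; apply: pinned_line; [exact: Wa.1|exact: Wb.1].
  move=> i; set U := _ \o _; have RU := ratfun_funring U.
  have rl : mx_in (ratfun U) (line a b).
    by move=> p q; apply: ratfun_poly; exact: mx_in_line.
  apply: (@funring_scalar_mx K _ _ RU 4 4 (coord _ i)).
  apply: (mx_in_mul RU) => //; apply: (mx_in_mul RU); last exact: mx_in_cst.
  by apply: mx_in_ratfun_inv => // t; exact: uW.
split.
  by move=> _ [P [pP dP] <-]; exists P => //; split=> //; exact: pinT.
have ltk : (k < size offdiag)%N by rewrite size_offdiag.
set P := (1%:M + delta_mx (nth (0, 0) offdiag k).1 (nth (0, 0) offdiag k).2 : 'M[K]_4).
have uP : P \in unitmx by exact: unitmx_add_delta.
have [||||h [rh hw h0]] := @orbit_separator K 3 'M[K]_4 unit (fun v _ => v) (fun=> E)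
  offdiag _ _ _ cent k (phi P) ltk.
- by move=> _ i j; apply: regular_linear => a u v; rewrite !mxE.
- by rewrite filter_uniq// enum_uniq.
- by rewrite mem_offdiag.
- by move=> _; rewrite !mulmxA mulmxV// mul1mx.
exists h => //; split; last first.
  exists (phi P); last by apply/eqP.
  by exists P => //; split; [apply: pinned_add_delta; rewrite // mem_offdiag|rewrite -unitfE -unitmxE].
move=> _ [Q [pQ dQ] <-]; have uQ : Q \in unitmx by rewrite unitmxE unitfE.
apply: (h0 _ Q) => //; first by apply: contraNneq dQ => ->; rewrite det0.
by move=> _; rewrite !mulmxA mulmxV// mul1mx.
Qed.

Lemma has_dim_conj_class (mu nu : K) : mu != nu -> mu != 0 -> nu != 0 ->
  has_dim (conj_class mu nu) 8.
Proof.
move=> munu mu0 nu0; split; first exact: zchain_conj_class.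
by move=> e Z chZ; exact: zchain_growth chZ (growth_conj_class mu nu).
Qed.

End ConjugacyClasses.

(** * Matrices of size two with prescribed traces *)

Section TwoByTwoMatrices.
Local Open Scope classical_set_scope.
Variable K : fieldType.

Definition mx22 (a b c d : K) : 'M[K]_2 :=
  \matrix_(i, j) if i == 0 then (if j == 0 then a else b) else (if j == 0 then c else d).

Lemma mx22E a b c d : (mx22 a b c d 0 0 = a) * (mx22 a b c d 0 1 = b) *
  (mx22 a b c d 1 0 = c) * (mx22 a b c d 1 1 = d).
Proof. by rewrite !mxE. Qed.

Lemma mx2P (A B : 'M[K]_2) : A 0 0 = B 0 0 -> A 0 1 = B 0 1 -> A 1 0 = B 1 0 ->
  A 1 1 = B 1 1 -> A = B.
Proof. by move=> a b c d; apply/matrixP; apply: ord2P; apply: ord2P. Qed.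

Lemma mx2_inv (A : 'M[K]_2) : \det A != 0 ->
  invmx A = (\det A)^-1 *: mx22 (A 1 1) (- A 0 1) (- A 1 0) (A 0 0).
Proof.
move=> d0; have uA : A \in unitmx by rewrite unitmxE unitfE.
rewrite -[RHS](mulKmx uA) -[LHS]mulmx1; congr (_ *m _).
rewrite -scalemxAr; apply: mx2P; rewrite [RHS]mxE mx2_mulE !mxE /=;
  move: d0; rewrite mx2_det => d0; by field.
Qed.

Lemma mx2_sqr (A : 'M[K]_2) : A *m A = \tr A *: A - (\det A)%:M.
Proof. by apply: mx2P; rewrite mx2_mulE mx2_trace mx2_det !mxE /=; ring. Qed.

Lemma char_poly2 (A : 'M[K]_2) mu nu : \tr A = mu + nu -> \det A = mu * nu ->
  char_poly A = \prod_(a <- [:: mu; nu]) ('X - a%:P).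
Proof.
rewrite mx2_trace mx2_det => trA detA; rewrite /char_poly mx2_det !mxE /= !mulr1n !mulr0n !sub0r.
rewrite !big_cons big_nil mulr1 mulrNN.
have -> : ('X - mu%:P) * ('X - nu%:P) = 'X ^+ 2 - (mu + nu)%:P * 'X + (mu * nu)%:P.
  by rewrite !rmorphD !rmorphM /=; ring.
by rewrite -trA -detA !(rmorphD, rmorphB, rmorphN, rmorphM) /=; ring.
Qed.

Lemma diag_with2I (A : 'M[K]_2) mu nu : mu != nu -> mu != 0 -> nu != 0 ->
  \tr A = mu + nu -> \det A = mu * nu -> diag_with [:: mu; nu] A.
Proof.
move=> munu mu0 nu0 trA detA; have chA := char_poly2 trA detA; split=> //.
  by rewrite unitmxE unitfE detA mulf_neq0.
apply/diagonalizableP; exists [:: mu; nu]; first by rewrite /= inE munu.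
by rewrite -chA mxminpoly_dvd_char.
Qed.

(* The matrix B of trace tau and determinant d with B 0 1 = s for which
   invmx B *m diag (t, u) has trace tau'. *)
Definition half (t u tau d tau' s : K) : 'M[K]_2 :=
  let a := (tau * t - d * tau') / (t - u) in
  mx22 a s ((a * (tau - a) - d) / s) (tau - a).

Lemma half_trace t u tau d tau' s : \tr (half t u tau d tau' s) = tau.
Proof. by rewrite mx2_trace !mxE /= addrC subrK. Qed.

Lemma half_det t u tau d tau' s : s != 0 -> \det (half t u tau d tau' s) = d.
Proof. by move=> s0; rewrite mx2_det !mxE /= [s * _]mulrC divfK//; ring. Qed.

Lemma half_inv_trace t u tau d tau' s : t != u -> d != 0 -> s != 0 ->
  \tr (invmx (half t u tau d tau' s) *m mx22 t 0 0 u) = tau'.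
Proof.
move=> tu d0 s0; rewrite mx2_inv half_det// -scalemxAl mxtraceZ.
rewrite mx2_trace !mx2_mulE !mxE /=.
have tu0 : t - u != 0 by rewrite subr_eq0.
by field; rewrite tu0 s0 d0.
Qed.

End TwoByTwoMatrices.

(** * Coordinates on rank two local systems with four punctures *)

Section FenchelNielsen.
Local Open Scope classical_set_scope.
Variables (K : numFieldType) (mu nu : 'I_4 -> K).
Hypotheses (munu : forall j, mu j != nu j) (mu0 : forall j, mu j != 0)
  (nu0 : forall j, nu j != 0) (prod1 : \prod_(j < 4) (mu j * nu j) = 1).

Let tau j := mu j + nu j.
Let d j := mu j * nu j.
Let del := d 0 * d 1.

Let d0 j : d j != 0. Proof. by rewrite mulf_neq0. Qed.
Let del0 : del != 0. Proof. by rewrite mulf_neq0. Qed.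

(* Fenchel-Nielsen type coordinates: t is an eigenvalue of the product of the first
   two matrices, s is the twist. *)
Definition fn (t s : K) (j : 'I_4) : 'M[K]_2 :=
  let u := mu 0 * nu 0 * (mu 1 * nu 1) / t in
  match val j with
  | 0 => half t u (mu 0 + nu 0) (mu 0 * nu 0) (mu 1 + nu 1) 1
  | 1 => invmx (half t u (mu 0 + nu 0) (mu 0 * nu 0) (mu 1 + nu 1) 1) *m mx22 t 0 0 u
  | 2 => half t^-1 u^-1 (mu i2 + nu i2) (mu i2 * nu i2) (mu i3 + nu i3) s
  | _ => invmx (half t^-1 u^-1 (mu i2 + nu i2) (mu i2 * nu i2) (mu i3 + nu i3) s)
         *m mx22 t^-1 0 0 u^-1
  end.

(** The middle condition separates the eigenvalues [t] and [u] of the first product; [half] divides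
    by their difference and by its last argument. *)
Definition fn_ok (t s : K) := [&& t != 0, t ^+ 2 != mu 0 * nu 0 * (mu 1 * nu 1) & s != 0].

Lemma fn_okP t s : fn_ok t s -> [/\ t != 0, s != 0, del / t != 0, t != del / t
  & t^-1 != (del / t)^-1].
Proof.
case/and3P => t0 td s0; have tu : t != del / t.
  by apply: contraNneq td => tu; rewrite expr2 {2}tu mulrC divfK.
split=> //; first by rewrite mulf_neq0// invr_eq0.
by rewrite (inj_eq invr_inj).
Qed.

Lemma fn_mul01 t s : fn_ok t s -> fn t s 0 *m fn t s 1 = mx22 t 0 0 (del / t).
Proof.
case/fn_okP => t0 s0 u0 tu tu'; rewrite /fn /= mulmxA mulmxV ?mul1mx//.
by rewrite unitmxE unitfE half_det ?oner_neq0// d0.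
Qed.

Lemma fn_local_system t s : fn_ok t s -> local_system mu nu (fn t s).
Proof.
move=> ok; have [t0 s0 u0 tu tu'] := fn_okP ok.
have uH1 : half t (del / t) (tau 0) (d 0) (tau 1) 1 \in unitmx.
  by rewrite unitmxE unitfE half_det ?oner_neq0.
have uH2 : half t^-1 (del / t)^-1 (tau i2) (d i2) (tau i3) s \in unitmx.
  by rewrite unitmxE unitfE half_det.
have detD (a b : K) : \det (mx22 a 0 0 b) = a * b.
  by rewrite mx2_det !mxE /= mul0r subr0.
split.
- apply: ord4P; rewrite /fn /=.
  + by rewrite half_trace half_det ?oner_neq0.
  + split; first exact: half_inv_trace tu (d0 0) (oner_neq0 _).
    rewrite det_mulmx det_inv half_det ?oner_neq0// detD.
    by field; rewrite t0 mu0 nu0.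
  + by rewrite half_trace half_det.
  + split; first exact: half_inv_trace tu' (d0 i2) s0.
    rewrite det_mulmx det_inv half_det// detD.
    (* The fourth determinant comes out as [(del * d i2)^-1], which [prod1] identifies with
       [d i3]. *)
    have := prod1; rewrite prod_ord4 => p1.
    have -> : t^-1 / (del / t) = del^-1 by field; rewrite del0 t0.
    by apply: (mulfI (d0 i2)); rewrite mulVKf ?d0//; apply: (mulfI del0); rewrite mulfV// mulrA -p1.
- rewrite prod_ord4 -!mulmxE fn_mul01// /fn /= -!mulmxA (mulmxA _ (invmx _)) mulmxV// mul1mx.
  by apply: mx2P; rewrite mx2_mulE !mxE /= ?(mul0r, mulr0, addr0, add0r) ?divff.
Qed.

Lemma fn_diag_with t s j : fn_ok t s -> diag_with [:: mu j; nu j] (fn t s j).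
Proof. by case/fn_local_system => /(_ j)[] trB detB _; exact: diag_with2I. Qed.

Lemma fn01 t s : fn t s 0 0 1 = 1.
Proof. by rewrite /fn /= !mxE. Qed.

(* The dependence on the twist hinges on this entry being nonzero. *)
Definition fn_entry (t : K) := fn t 1 0 1 0.

(** As a function of [s] the trace is a Laurent polynomial in which [s] has coefficient [- t / d 0]
    times [fn_entry t]; it is not constant. *)
Lemma fn_twist t c : fn_ok t 1 -> fn_entry t != 0 ->
  exists2 s, fn_ok t s & \tr (fn t s 1 *m fn t s i2) != c.
Proof.
move=> ok e0; have [t0 _ u0 tu tu'] := fn_okP ok.
rewrite /fn_entry in e0.
pose H := half t (del / t) (tau 0) (d 0) (tau 1) 1.
have detH : \det H = d 0 by rewrite half_det ?oner_neq0.
pose H' := half t^-1 (del / t)^-1 (tau i2) (d i2) (tau i3) 1.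
have trE s : s != 0 -> \tr (fn t s 1 *m fn t s i2) = (d 0)^-1 *
    (H 1 1 * t * H' 0 0 - (del / t) * H' 1 0 / s - H 1 0 * t * s + H 0 0 * (del / t) * H' 1 1).
  move=> s0.
  have -> : fn t s i2 = mx22 (H' 0 0) s (H' 1 0 / s) (H' 1 1).
    by apply: mx2P; rewrite !mxE //= divr1.
  have -> : fn t s 1 = (d 0)^-1 *: (mx22 (H 1 1) (- 1) (- H 1 0) (H 0 0) *m mx22 t 0 0 (del / t)).
    rewrite scalemxAl -detH; congr (_ *m _); rewrite mx2_inv ?detH ?d0//.
    by congr (_ *: mx22 _ _ _ _); rewrite mxE.
  rewrite -scalemxAl mxtraceZ; congr (_ * _); rewrite mx2_trace !mx2_mulE !mxE /=; ring.
pose C := H 1 1 * t * H' 0 0 + H 0 0 * (del / t) * H' 1 1 - d 0 * c.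
(* The value of [p] at [s] is the difference of the trace and [c], times [d 0 * s ^+ 2]; the surplus
   factor [s] keeps the nonroot away from 0. *)
pose p : {poly K} := 'X * ((- H 1 0 * t)%:P * 'X ^+ 2 + C%:P * 'X - (del / t * H' 1 0)%:P).
have /poly_nonroot[s] : p != 0.
  rewrite mulf_neq0 ?polyX_eq0//; apply/eqP => /(congr1 (fun q : {poly K} => q`_2)).
  rewrite coefB coefD !coefCM coefXn coefX coefC coef0 /= mulr1 mulr0 addr0 subr0.
  by apply/eqP; rewrite mulNr oppr_eq0 mulf_neq0.
rewrite /p !(hornerD, hornerN, hornerM, hornerC, hornerXn, hornerX) mulf_eq0 negb_or => /andP[s0 ps].
exists s; first by case/and3P: ok => tt0 td _; apply/and3P; split.
apply: contraNneq ps => trc; have := trE s s0; rewrite trc => defc.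
have {}defc : d 0 * c = H 1 1 * t * H' 0 0 - (del / t) * H' 1 0 / s - H 1 0 * t * s +
    H 0 0 * (del / t) * H' 1 1.
  by rewrite defc mulVKf ?d0.
by rewrite /C defc; apply/eqP; field; rewrite s0 t0.
Qed.

Lemma fn_good (l : seq K) : exists t, [/\ fn_ok t 1, fn_entry t != 0 & t \notin l].
Proof.
(* If [a] is the upper left entry of [half], then [fn_entry t] is [- (a - mu 0) * (a - nu 0)].
   Multiplied by [t ^+ 2 - del], the factors become [q (mu 0) (nu 0)] and [q (nu 0) (mu 0)] at
   [t]. *)
pose q (m n : K) : {poly K} := n%:P * 'X ^+ 2 - (d 0 * tau 1)%:P * 'X + (m * del)%:P.
have q0 m n : n != 0 -> q m n != 0.
  move=> n0; apply/eqP => /(congr1 (fun q : {poly K} => q`_2)).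
  rewrite coefD coefB !coefCM coefXn coefX coefC coef0 /= mulr1 mulr0 addr0 subr0.
  exact/eqP.
have Xd0 : 'X ^+ 2 - del%:P != 0 :> {poly K}.
  by apply: monic_neq0; exact: monicXnsubC.
have : (\prod_(z <- l) ('X - z%:P)) * 'X * ('X ^+ 2 - del%:P) * q (mu 0) (nu 0) * q (nu 0) (mu 0) != 0.
  rewrite !mulf_neq0 ?q0 ?polyX_eq0// prodf_seq_neq0.
  by apply/allP => z _; rewrite polyXsubC_eq0.
case/poly_nonroot => t; rewrite !hornerM !mulf_eq0 !negb_or horner_prod prodf_seq_neq0.
case/andP => /andP[/andP[/andP[/allP lt t0] td] q1] q2; exists t.
rewrite hornerX in t0; have ok : fn_ok t 1.
  rewrite /fn_ok t0 oner_neq0 andbT /=.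
  by move: td; rewrite !(hornerD, hornerN, hornerM, hornerC, hornerXn, hornerX) subr_eq0.
have [_ _ u0 tu _] := fn_okP ok.
split=> //; last by apply/negP => /lt; rewrite !hornerE subrr eqxx.
have tu0 : t - del / t != 0 by rewrite subr_eq0.
have td0 : t ^+ 2 - del != 0 by move: td; rewrite !(hornerD, hornerN, hornerM, hornerC, hornerXn, hornerX).
have -> : fn_entry t = - ((q (mu 0) (nu 0)).[t] * (q (nu 0) (mu 0)).[t]) / (t ^+ 2 - del) ^+ 2.
  rewrite /fn_entry /fn /= !mxE /= /q.
  rewrite !(hornerD, hornerN, hornerM, hornerC, hornerXn, hornerX) /tau /del /d; field.
  by rewrite t0 andbT; move: td0; rewrite /del /d.
by rewrite mulf_neq0 ?invr_eq0 ?oppr_eq0 ?expf_neq0// mulf_neq0.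
Qed.

Lemma mx_in_fn U (T S : K -> K) j : ratfun U T -> ratfun U S ->
  (forall x, U x -> fn_ok (T x) (S x)) -> mx_in (ratfun U) (fun x => fn (T x) (S x) j).
Proof.
move=> rT rS ok; have RU := @ratfun_funring K U.
have rC c : ratfun U (fun=> c) by exact: (funring_cst RU).
have rM f g : ratfun U f -> ratfun U g -> ratfun U (fun x => f x * g x).
  exact: (funring_mul RU).
have rB f g : ratfun U f -> ratfun U g -> ratfun U (fun x => f x - g x).
  exact: (funring_sub RU).
have rI := @ratfun_inv K U.
have r22 a b c e : ratfun U a -> ratfun U b -> ratfun U c -> ratfun U e ->
    mx_in (ratfun U) (fun x => mx22 (a x) (b x) (c x) (e x)).
  move=> ra rb rc re.
  by apply: ord2P; apply: ord2P; [move: ra|move: rb|move: rc|move: re] => /funring_ext;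
    apply=> x; rewrite mxE.
have rhalf (t u s : K -> K) (k l n : K) : ratfun U t -> ratfun U u -> ratfun U s ->
    (forall x, U x -> t x != u x) -> (forall x, U x -> s x != 0) ->
    mx_in (ratfun U) (fun x => half (t x) (u x) k l n (s x)).
  move=> rt ru rs tu s0.
  have ra : ratfun U (fun x => (k * t x - l * n) / (t x - u x)).
    apply: (rM); first by apply: (rB) => //; apply: (rM).
    by apply: (rI); [apply: (rB)|move=> x Ux; rewrite subr_eq0 tu].
  apply: r22 => //; last by apply: (rB).
  apply: (rM); last exact: rI.
  by apply: (rB) => //; apply: (rM) => //; apply: (rB).
have okU x : U x -> _ := fun Ux => fn_okP (ok x Ux).
have rV : ratfun U (fun x => (T x)^-1) by apply: (rI) => // x /okU[].
have ru : ratfun U (fun x => del / T x) by apply: (rM).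
have ruV : ratfun U (fun x => (del / T x)^-1) by apply: (rI) => // x /okU[].
have rH1 : mx_in (ratfun U) (fun x => half (T x) (del / T x) (tau 0) (d 0) (tau 1) 1).
  by apply: rhalf => // [x /okU[]//|x _]; exact: oner_neq0.
have rH2 : mx_in (ratfun U) (fun x => half (T x)^-1 (del / T x)^-1 (tau i2) (d i2) (tau i3) (S x)).
  by apply: rhalf => // x /okU[].
move: j; apply: ord4P => //.
- apply: (mx_in_mul RU); last by apply: r22.
  apply: mx_in_ratfun_inv => // x _.
  rewrite unitmxE unitfE half_det ?oner_neq0//; exact: (d0 0).
- apply: (mx_in_mul RU); last by apply: r22.
  apply: mx_in_ratfun_inv => // x /okU[_ s0 _ _ _].
  rewrite unitmxE unitfE half_det//; exact: (d0 i2).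
Qed.

End FenchelNielsen.

(** * Conjugation invariants of block diagonal quadruples *)

Section BlockQuadruples.
Local Open Scope classical_set_scope.
Variable K : fieldType.
Implicit Types (B G : 'I_4 -> 'M[K]_2).

Lemma block_quadruple_mul B G i j : block_quadruple B G i *m block_quadruple B G j =
  block_mx (B i *m B j) 0 0 (G i *m G j) :> 'M_(2 + 2).
Proof.
rewrite /block_quadruple (@mulmx_block _ 2 2 2 2 2 2).
by rewrite !(mul0mx, mulmx0, addr0, add0r).
Qed.

Lemma prod_block_quadruple B G : \prod_(j < 4) B j = 1 -> \prod_(j < 4) G j = 1 ->
  \prod_(j < 4) block_quadruple B G j = 1.
Proof.
rewrite !prod_ord4 -!mulmxE => B1 G1.
rewrite block_quadruple_mul /block_quadruple.
rewrite [X in X *m _](@mulmx_block _ 2 2 2 2 2 2) (@mulmx_block _ 2 2 2 2 2 2).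
rewrite !(mul0mx, mulmx0, addr0, add0r) B1 G1.
exact: (esym (@scalar_mx_block _ 2 2 1)).
Qed.

Lemma mx2_char0 (A : 'M[K]_2) mu nu : \tr A = mu + nu -> \det A = mu * nu ->
  (A - mu%:M) *m (A - nu%:M) = 0.
Proof.
rewrite mx2_trace mx2_det => trA detA; have A11 : A 1 1 = mu + nu - A 0 0 by rewrite -trA; ring.
move: detA; rewrite A11 => /eqP; rewrite -subr_eq0 => /eqP detA.
apply: mx2P; rewrite mx2_mulE !mxE /= ?mulr1n ?mulr0n ?A11.
- by rewrite -[RHS]oppr0 -[in RHS]detA; ring.
- by ring.
- by ring.
- by rewrite -[RHS]oppr0 -[in RHS]detA; ring.
Qed.

Lemma conj_mul n (P X Y : 'M[K]_n) : P \in unitmx ->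
  (invmx P *m X *m P) *m (invmx P *m Y *m P) = invmx P *m (X *m Y) *m P.
Proof. by move=> uP; rewrite !mulmxA mulmxK. Qed.

Lemma conj_trace n (P X : 'M[K]_n) : P \in unitmx -> \tr (invmx P *m X *m P) = \tr X.
Proof. by move=> uP; rewrite mxtrace_mulC mulmxA mulmxV// mul1mx. Qed.

Lemma conj_det n (P X : 'M[K]_n) : P \in unitmx -> \det (invmx P *m X *m P) = \det X.
Proof. by move=> uP; rewrite !det_mulmx mulrAC -det_mulmx mulVmx// det1 mul1r. Qed.

(* This determinant detects whether one of the 2 x 2 blocks of X, of determinant e,
   has trace c. *)
Definition trace_form n c e (X : 'M[K]_n) := \det (X *m X - c *: X + e%:M).

Lemma trace_form_conj n c e (P X : 'M[K]_n) : P \in unitmx ->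
  trace_form c e (invmx P *m X *m P) = trace_form c e X.
Proof.
move=> uP; rewrite /trace_form conj_mul// -(conj_det (X *m X - c *: X + e%:M) uP).
congr (\det _); rewrite mulmxDr mulmxDl mulmxBr mulmxBl; congr (_ - _ + _).
  by rewrite -scalemxAr -scalemxAl.
by rewrite mul_mx_scalar -scalemxAl mulVmx// scalemx1.
Qed.

(** By Cayley-Hamilton the matrix under the determinant is [(\tr A - c) *: A] on each block [A]. *)
Lemma trace_form_block c e (X Y : 'M[K]_2) : \det X = e -> \det Y = e ->
  trace_form c e (block_mx X 0 0 Y) =
  ((\tr X - c) ^+ 2 * e) * ((\tr Y - c) ^+ 2 * e).
Proof.
move=> dX dY.
have sqr (A : 'M[K]_2) : \det A = e -> \det (A *m A - c *: A + e%:M) = (\tr A - c) ^+ 2 * e.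
  move=> dA; rewrite mx2_sqr dA.
  have -> : \tr A *: A - e%:M - c *: A + e%:M = (\tr A - c) *: A.
    by rewrite scalerBl addrAC subrK.
  by rewrite detZ dA.
rewrite /trace_form mulmx_block scale_block_mx opp_block_mx scalar_mx_block !add_block_mx.
by rewrite !(mul0mx, mulmx0, scaler0, oppr0, addr0, add0r) det_ublock !sqr.
Qed.

End BlockQuadruples.

(** * A rational family inside N *)

Section DimensionOfVarN.
Local Open Scope classical_set_scope.
Variables (K : numFieldType) (mu nu : 'I_4 -> K).
Hypotheses (munu : forall j, mu j != nu j) (mu0 : forall j, mu j != 0)
  (nu0 : forall j, nu j != 0) (prod1 : \prod_(j < 4) (mu j * nu j) = 1).

Let V := {ffun 'I_4 -> 'M[K]_4}.
Let E := ('M[K]_4 * 'rV[K]_4)%type.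
Let del := mu 0 * nu 0 * (mu 1 * nu 1).

(** Each twist precedes its eigenvalue because it is freed first: the trace of the product of the
    first two matrices does not depend on it and can still detect the eigenvalue. *)
Definition fn_left (r : 'rV[K]_4) := fn mu nu (r 0 1) (r 0 0).
Definition fn_right (r : 'rV[K]_4) := fn mu nu (r 0 i3) (r 0 i2).

Definition fn_family (x : E) : V :=
  [ffun j => invmx x.1 *m block_quadruple (fn_left x.2) (fn_right x.2) j *m x.1].

(* For nonzero t and t', the last factor vanishes when {t, del / t} = {t', del / t'}. *)
Definition fn_disc (x : E) : K := \det x.1 *
  (x.2 0 1 * (x.2 0 1 ^+ 2 - del) * x.2 0 0) * (x.2 0 i3 * (x.2 0 i3 ^+ 2 - del) * x.2 0 i2) *
  ((x.2 0 1 - x.2 0 i3) * (x.2 0 1 * x.2 0 i3 - del)).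

Lemma fn_discP x : fn_disc x != 0 <->
  [/\ x.1 \in unitmx, fn_ok mu nu (x.2 0 1) (x.2 0 0), fn_ok mu nu (x.2 0 i3) (x.2 0 i2)
    & x.2 0 1 != x.2 0 i3 /\ x.2 0 1 * x.2 0 i3 != del].
Proof.
rewrite /fn_disc /fn_ok !mulf_eq0 !negb_or !subr_eq0 unitmxE unitfE -!andbA.
split=> [|[-> /and3P[-> -> ->] /and3P[-> -> ->] [-> ->]]//].
by do 8![case/andP => ->] => ->.
Qed.

Lemma fn_family_varN x : fn_disc x != 0 -> varN mu nu (fn_family x).
Proof.
case/fn_discP => uP okl okr [tt' ttd].
have [tdl prl] := fn_local_system mu0 nu0 prod1 okl.
have [tdr prr] := fn_local_system mu0 nu0 prod1 okr.
split.
- move=> j; rewrite /conj_class /= ffunE; have [trl detl] := tdl j; have [trr detr] := tdr j.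
  apply: (@diag_withI _ 3 (mu j) (nu j)) => //=.
  + by rewrite mu0 nu0.
  + rewrite [LHS](char_poly_block_diag (fn_left x.2 j) (fn_right x.2 j)).
    rewrite (char_poly2 trl detl) (char_poly2 trr detr) !big_cons big_nil; ring.
  + suff : (block_mx (fn_left x.2 j) 0 0 (fn_right x.2 j) - (mu j)%:M) *m
      (block_mx (fn_left x.2 j) 0 0 (fn_right x.2 j) - (nu j)%:M) = 0 by [].
    rewrite !(@scalar_mx_block _ 2 2) !opp_block_mx !add_block_mx.
    rewrite (@mulmx_block _ 2 2 2 2 2 2) !(subrr, oppr0, add0r, mul0mx, mulmx0, addr0).
    by rewrite !mx2_char0// block_mx0.
- rewrite (eq_bigr (fun j => invmx x.1 *m block_quadruple (fn_left x.2) (fn_right x.2) j *m x.1)).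
    by rewrite prod_conj// prod_block_quadruple// mulmx1 mulVmx.
  by move=> j _; rewrite ffunE.
exists (fn_left x.2), (fn_right x.2); split=> //.
- by exists x.1 => // j; rewrite ffunE.
- by move=> j; split; exact: fn_diag_with.
(* An equivalence of the blocks would equate the traces [t + del / t] of their first products, which
   the last factor of [fn_disc] excludes. *)
case=> P uP2 conjP; have := conj_trace (fn_left x.2 0 *m fn_left x.2 1) uP2.
rewrite -conj_mul// -!conjP /fn_left /fn_right !fn_mul01// !mx2_trace !mxE /= => tr_eq.
have [t0 _ _ _ _] := fn_okP mu0 nu0 okl; have [t0' _ _ _ _] := fn_okP mu0 nu0 okr.
have : (x.2 0 1 - x.2 0 i3) * (x.2 0 1 * x.2 0 i3 - del) = 0.
  transitivity ((x.2 0 1 + del / x.2 0 1 - (x.2 0 i3 + del / x.2 0 i3)) * (x.2 0 1 * x.2 0 i3)).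
    by field; rewrite t0 t0'.
  by rewrite /del tr_eq subrr mul0r.
by move/eqP; rewrite mulf_eq0 !subr_eq0 (negbTE tt') (negbTE ttd).
Qed.

Lemma fn_family_mul x i j : x.1 \in unitmx -> fn_family x i *m fn_family x j =
  invmx x.1 *m block_mx (fn_left x.2 i *m fn_left x.2 j) 0 0
    (fn_right x.2 i *m fn_right x.2 j) *m x.1.
Proof. by move=> uP; rewrite !ffunE conj_mul// block_quadruple_mul. Qed.

Lemma fn_family_trace x i j : x.1 \in unitmx -> \tr (fn_family x i *m fn_family x j) =
  \tr (fn_left x.2 i *m fn_left x.2 j) + \tr (fn_right x.2 i *m fn_right x.2 j).
Proof. by move=> uP; rewrite fn_family_mul// conj_trace//; exact: (@mxtrace_block _ 2 2 _ 0 0). Qed.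

Lemma fn_family_trace_form c e x i j : x.1 \in unitmx ->
  \det (fn_left x.2 i *m fn_left x.2 j) = e -> \det (fn_right x.2 i *m fn_right x.2 j) = e ->
  trace_form c e (fn_family x i *m fn_family x j) =
  ((\tr (fn_left x.2 i *m fn_left x.2 j) - c) ^+ 2 * e) *
  ((\tr (fn_right x.2 i *m fn_right x.2 j) - c) ^+ 2 * e).
Proof.
by move=> uP dl dr; rewrite fn_family_mul// trace_form_conj//; exact: trace_form_block.
Qed.

Lemma regular_entry i : mx_in (@regular K V) (fun v => v i).
Proof. by move=> p q; apply: regular_linear => a u v; rewrite !ffunE !mxE. Qed.

Lemma regular_trace2 i j c : @regular K V (fun v => \tr (v i *m v j) - c).
Proof.
have RF := @regular_funring K V; apply: (funring_sub RF); last exact: (funring_cst RF).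
by apply: (funring_trace RF); apply: (mx_in_mul RF); exact: regular_entry.
Qed.

Lemma regular_trace_form c e i j : @regular K V (fun v => trace_form c e (v i *m v j)).
Proof.
have RF := @regular_funring K V.
have rX : mx_in (@regular K V) (fun v => v i *m v j).
  by apply: (mx_in_mul RF); exact: regular_entry.
apply: (funring_det RF); apply: (mx_in_add RF); last exact: mx_in_cst.
apply: (mx_in_add RF (mx_in_mul RF rX rX)) => p q.
apply: funring_ext (mx_in_scale RF (funring_cst RF (- c)) rX p q) _ => v.
by rewrite scaleNr.
Qed.

Lemma disc_line a b : polyfun (fun t => fn_disc (line a b t)).
Proof.
have PF := polyfun_funring K; have rC := funring_cst PF del.
have pr i : polyfun (fun t => (line a b t).2 0 i) by exact: (mx_in_line a.2 b.2 0 i).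
have mP (f g : K -> K) : polyfun f -> polyfun g -> polyfun (fun t => f t * g t) by exact: (funring_mul PF).
have bP (f g : K -> K) : polyfun f -> polyfun g -> polyfun (fun t => f t - g t) by exact: (funring_sub PF).
have h i k : polyfun (fun t => (line a b t).2 0 i * ((line a b t).2 0 i ^+ 2 - del) * (line a b t).2 0 k).
  by apply: (mP) => //; apply: (mP) => //; apply: (bP) => //; exact: (funring_exp PF).
apply: (mP); last by apply: (mP); [apply: (bP)|apply: (bP) => //; apply: (mP)].
apply: (mP); last exact: h.
apply: (mP); last exact: h.
by apply: (funring_det PF); exact: (mx_in_line a.1 b.1).
Qed.

Lemma ratfun_fn_family (U : set K) a b i : (forall t, U t -> fn_disc (line a b t) != 0) ->
  ratfun U (fun t => coord (vbasis {:V}) i (fn_family (line a b t))).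
Proof.
move=> dU; have RU := @ratfun_funring K U.
have okU t (Ut : U t) := (fn_discP _).1 (dU t Ut).
have pr j : ratfun U (fun t => (line a b t).2 0 j).
  by apply: ratfun_poly; exact: (mx_in_line a.2 b.2 0 j).
have rP : mx_in (ratfun U) (fun t => (line a b t).1).
  by move=> p q; apply: ratfun_poly; exact: (mx_in_line a.1 b.1).
apply: (@funring_scalar_ffun K _ _ RU 'I_4 4 4 (coord _ i)) => j p q.
have : mx_in (ratfun U) (fun t => invmx (line a b t).1 *m
    block_quadruple (fn_left (line a b t).2) (fn_right (line a b t).2) j *m (line a b t).1).
  apply: (mx_in_mul RU) => //; apply: (mx_in_mul RU).
    by apply: mx_in_ratfun_inv => // t /okU[].
  apply: (@mx_in_block K K _ 2 2 2 2); try exact: mx_in_cst.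
    by apply: mx_in_fn => // t /okU[].
  by apply: mx_in_fn => // t /okU[].
by move=> /(_ p q)/funring_ext; apply=> t; rewrite ffunE.
Qed.

End DimensionOfVarN.

(** * Matrices commuting with a diagonal matrix *)

Section Centralizer.
Local Open Scope classical_set_scope.
Variable K : fieldType.

Lemma mul_diag_mxl n (C X : 'M[K]_n) i j : (forall i j, i != j -> C i j = 0) ->
  (C *m X) i j = C i i * X i j.
Proof.
move=> C0; rewrite mxE (bigD1 i)//= big1 ?addr0// => k ki.
by rewrite C0 ?mul0r// eq_sym.
Qed.

Lemma mul_diag_mxr n (C X : 'M[K]_n) i j : (forall i j, i != j -> C i j = 0) ->
  (X *m C) i j = X i j * C j j.
Proof.
move=> C0; rewrite mxE (bigD1 j)//= big1 ?addr0// => k kj.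
by rewrite C0 ?mulr0.
Qed.

Lemma commute_diag n (C D : 'M[K]_n) : (forall i j, i != j -> D i j = 0) ->
  (forall i j, D i i = D j j -> i = j) -> C *m D = D *m C ->
  forall i j, i != j -> C i j = 0.
Proof.
move=> D0 Dinj CD i j ij; have := congr1 (fun M : 'M_n => M i j) CD.
rewrite mul_diag_mxr// mul_diag_mxl// mulrC => /eqP.
rewrite -subr_eq0 -mulrBl mulf_eq0 => /orP[|/eqP//].
by rewrite subr_eq0 => /eqP/Dinj ji; rewrite ji eqxx in ij.
Qed.

Lemma block_diag4 (A B : 'M[K]_2) (X := block_mx A 0 0 B : 'M[K]_4) :
  [/\ X 0 0 = A 0 0, X 1 1 = A 1 1, X i2 i2 = B 0 0 & X i3 i3 = B 1 1] /\
  [/\ X 0 1 = A 0 1 & X i2 i3 = B 0 1].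
Proof.
have e0 : (0 : 'I_4) = lshift 2 (0 : 'I_2) by exact/val_inj.
have e1 : (1 : 'I_4) = lshift 2 (1 : 'I_2) by exact/val_inj.
have e2 : i2 = rshift 2 (0 : 'I_2) by exact/val_inj.
have e3 : i3 = rshift 2 (1 : 'I_2) by exact/val_inj.
by rewrite /X e0 e1 e2 e3 !(@block_mxEul K 2 2 2 2) !(@block_mxEdr K 2 2 2 2).
Qed.

Lemma block_diag4_offdiag (a b c d : K) (X := block_mx (mx22 a 0 0 b) 0 0 (mx22 c 0 0 d) : 'M[K]_4) i j :
  i != j -> X i j = 0.
Proof.
have mx22_0 (x y : K) k l : k != l -> mx22 x 0 0 y k l = 0.
  by move: k l; apply: ord2P; apply: ord2P; rewrite mxE.
rewrite /X; case: (@split_ordP 2 2 i) => k ->; case: (@split_ordP 2 2 j) => l -> kl.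
- by rewrite (@block_mxEul K 2 2 2 2) mx22_0//; apply: contraNneq kl => ->.
- by rewrite (@block_mxEur K 2 2 2 2) mxE.
- by rewrite (@block_mxEdl K 2 2 2 2) mxE.
- by rewrite (@block_mxEdr K 2 2 2 2) mx22_0//; apply: contraNneq kl => ->.
Qed.

Lemma add_div_neq (del t t' : K) : t != 0 -> t' != 0 -> t != t' -> t * t' != del ->
  t + del / t != t' + del / t'.
Proof.
move=> t0 t0' tt' ttd; rewrite -subr_eq0.
have -> : t + del / t - (t' + del / t') = (t - t') * (t * t' - del) / (t * t').
  by field; rewrite t0 t0'.
by rewrite !mulf_neq0 ?subr_eq0 ?invr_eq0 ?mulf_neq0.
Qed.

Lemma notin_pair (del t t' : K) : t' != 0 -> t \notin [:: t'; del / t'] ->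
  t != t' /\ t * t' != del.
Proof.
move=> t0'; rewrite !inE negb_or => /andP[tt' td]; split=> //.
by apply: contraNneq td => <-; rewrite mulfK.
Qed.

End Centralizer.

(** * The centralizer of a block quadruple *)

Section LowerBound.
Local Open Scope classical_set_scope.
Variables (K : numFieldType) (mu nu : 'I_4 -> K).
Hypotheses (munu : forall j, mu j != nu j) (mu0 : forall j, mu j != 0)
  (nu0 : forall j, nu j != 0) (prod1 : \prod_(j < 4) (mu j * nu j) = 1).

Let del := mu 0 * nu 0 * (mu 1 * nu 1).

(** The product of the first two matrices is diagonal with four distinct entries, so [C] is
    diagonal. The entry 1 above the diagonal in each block of the first matrix then equates the two
    diagonal entries of [C] in that block. *)
Lemma fn_centralizer (r : 'rV[K]_4) (C : 'M[K]_4) :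
  fn_ok mu nu (r 0 1) (r 0 0) -> fn_ok mu nu (r 0 i3) (r 0 i2) ->
  r 0 1 != r 0 i3 -> r 0 1 * r 0 i3 != del ->
  (forall j, C *m block_quadruple (fn_left mu nu r) (fn_right mu nu r) j =
             block_quadruple (fn_left mu nu r) (fn_right mu nu r) j *m C) ->
  [/\ forall i j, i != j -> C i j = 0, C 0 0 = C 1 1 & C i2 i2 = C i3 i3].
Proof.
move=> okl okr tt' ttd CM.
have [t0 _ u0 tu _] := fn_okP mu0 nu0 okl; have [t0' _ u0' tu' _] := fn_okP mu0 nu0 okr.
pose D : 'M[K]_4 := block_mx (mx22 (r 0 1) 0 0 (del / r 0 1)) 0 0 (mx22 (r 0 i3) 0 0 (del / r 0 i3)).
have defD : block_quadruple (fn_left mu nu r) (fn_right mu nu r) 0 *m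
    block_quadruple (fn_left mu nu r) (fn_right mu nu r) 1 = D.
  by rewrite block_quadruple_mul /fn_left /fn_right !fn_mul01.
have C0 : forall i j, i != j -> C i j = 0.
  apply: (@commute_diag _ _ _ D); first by move=> i j; exact: block_diag4_offdiag.
    have [[D0 D1 D2 D3] _] := block_diag4 (mx22 (r 0 1) 0 0 (del / r 0 1)) (mx22 (r 0 i3) 0 0 (del / r 0 i3)).
    rewrite -/D !mx22E in D0 D1 D2 D3.
    have n12 : r 0 1 != del / r 0 i3 by apply: contraNneq ttd => ->; rewrite divfK.
    have n21 : del / r 0 1 != r 0 i3 by apply: contraNneq ttd => <-; rewrite mulrC divfK.
    have n22 : del / r 0 1 != del / r 0 i3.
      have d0 : del != 0 by rewrite !mulf_neq0.
      by rewrite (inj_eq (mulfI d0)) (inj_eq invr_inj).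
    pose l := [:: r 0 1; del / r 0 1; r 0 i3; del / r 0 i3].
    have Dl : forall i, D i i = nth 0 l i.
      by apply: ord4P; rewrite /l /= ?D0 ?D1 ?D2 ?D3.
    move=> i j /eqP; rewrite !Dl nth_uniq ?size_tuple ?ltn_ord//; last first.
      by rewrite /= !inE !negb_or tu tt' n12 n21 n22 tu'.
    by move/eqP/val_inj.
  by rewrite -defD mulmxA CM -!mulmxA CM.
have [_ [X01 X23]] := block_diag4 (fn_left mu nu r 0) (fn_right mu nu r 0).
rewrite /fn_left /fn_right !fn01 in X01 X23.
split=> //.
- have := congr1 (fun M : 'M_4 => M 0 1) (CM 0).
  by rewrite mul_diag_mxl// mul_diag_mxr// /block_quadruple X01 mulr1 mul1r.
- have := congr1 (fun M : 'M_4 => M i2 i3) (CM 0).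
  by rewrite mul_diag_mxl// mul_diag_mxr// /block_quadruple X23 mulr1 mul1r.
Qed.

(** The 14 = 16 - 2 directions transverse to the centralizer: (0, 0) is the reference entry of
    [pinned], and (i2, i2) ties the scalar of the second block to that of the first. *)
Definition slice : seq ('I_4 * 'I_4) :=
  filter (fun p : 'I_4 * 'I_4 => p \notin [:: (0, 0); (i2, i2)]) (enum {: 'I_4 * 'I_4}).

Lemma mem_slice p : (p \in slice) = (p \notin [:: (0, 0); (i2, i2)]).
Proof. by rewrite mem_filter mem_enum andbT. Qed.

Lemma size_slice : size slice = 14.
Proof. by rewrite size_filter_pairs !big_ord_recl !big_ord0. Qed.

Lemma fn_pinned_centralizer (r : 'rV[K]_4) p (C : 'M[K]_4) :
  fn_ok mu nu (r 0 1) (r 0 0) -> fn_ok mu nu (r 0 i3) (r 0 i2) ->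
  r 0 1 != r 0 i3 -> r 0 1 * r 0 i3 != del -> p \in slice ->
  (forall j, C *m block_quadruple (fn_left mu nu r) (fn_right mu nu r) j =
             block_quadruple (fn_left mu nu r) (fn_right mu nu r) j *m C) ->
  pinned (mem slice) 0 (C *m (1%:M + delta_mx p.1 p.2)) -> exists a, C = a%:M.
Proof.
move=> okl okr tt' ttd ps CM pC; exists (C 0 0).
have [C0 C01 C23] := fn_centralizer okl okr tt' ttd CM.
have ds (k : 'I_4) : (k, k) \in [:: (0, 0); (i2, i2)] -> (1%:M + delta_mx p.1 p.2 : 'M[K]_4) k k = 1.
  move=> ks; rewrite !mxE eqxx; case: andP => [[/eqP kp1 /eqP kp2]|_]; last by rewrite addr0.
  by move: ps; rewrite mem_slice (surjective_pairing p) -kp1 -kp2 ks.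
(* As [p] is neither (0, 0) nor (i2, i2), the added [delta_mx] leaves these two diagonal entries
   alone, and pinning equates them. *)
have C2 : C i2 i2 = C 0 0.
  have := pC i2 i2; rewrite mul_diag_mxl// mul_diag_mxl// !ds ?inE ?eqxx ?orbT//.
  by rewrite !mulr1 mul1r; apply; rewrite /= mem_slice !inE eqxx orbT.
apply/matrixP => i j; rewrite mxE; have [<-|ij] := eqVneq i j; last by rewrite mulr0n C0.
by move: i; apply: ord4P; rewrite mulr1n // -?C23 ?C2.
Qed.

Definition row4 (s t s' t' : K) : 'rV[K]_4 :=
  \row_j match val j with 0 => s | 1 => t | 2 => s' | _ => t' end.

Lemma row4E s t s' t' : [/\ row4 s t s' t' 0 0 = s, row4 s t s' t' 0 1 = t,
  row4 s t s' t' 0 i2 = s' & row4 s t s' t' 0 i3 = t'].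
Proof. by rewrite !mxE. Qed.

End LowerBound.

(** * The chain of length 18 in N *)

Section ChainInVarN.
Local Open Scope classical_set_scope.
Variables (K : numFieldType) (mu nu : 'I_4 -> K).
Hypotheses (munu : forall j, mu j != nu j) (mu0 : forall j, mu j != 0)
  (nu0 : forall j, nu j != 0) (prod1 : \prod_(j < 4) (mu j * nu j) = 1).

Let V := {ffun 'I_4 -> 'M[K]_4}.
Let E := ('M[K]_4 * 'rV[K]_4)%type.
Let del := mu 0 * nu 0 * (mu 1 * nu 1).

(* First the conjugating matrix varies in a slice transverse to the scalars of the two
   blocks, then the coordinates r0 0, ..., r0 3 are freed one after the other. *)
Definition chain_dom (r0 : 'rV[K]_4) (k : nat) : set E := [set x : E |
  [/\ pinned (mem (take k slice)) 0 x.1,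
      forall l : 'I_4, (k - 14 <= l)%N -> x.2 0 l = r0 0 l & fn_disc mu nu x != 0]].

Lemma chain_dom_sub r0 k : chain_dom r0 k `<=` chain_dom r0 k.+1.
Proof.
move=> x [px xr dx]; split=> //; first exact: pinned_take.
by move=> l lel; apply: xr; apply: leq_trans lel; exact: leq_sub2r.
Qed.

Lemma chain_dom_integral r0 k : integral_on (fn_family mu nu @` chain_dom r0 k).
Proof.
apply: (@integral_image K V E) => a b [pa ra da] [pb rb db].
  exists (fun t => fn_disc mu nu (line (E := E) a b t)); first exact: disc_line.
  move=> t; split=> [dt|[]//]; split=> //.
    exact: (@pinned_line K 4 _ 0 a.1 b.1 t pa pb).
  move=> l lel; have /(_ l lel) := ra; have /(_ l lel) := rb; move=> rbl ral.
  suff : (line a.2 b.2 t) 0 l = r0 0 l by [].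
  by rewrite !mxE ral rbl subrr mulr0 addr0.
by move=> i; apply: ratfun_fn_family => // t [].
Qed.

Lemma chain_dom_row4 (r0 : 'rV[K]_4) k s t s' t' :
  fn_ok mu nu t s -> fn_ok mu nu t' s' -> t != t' -> t * t' != del ->
  (forall l : 'I_4, (k - 14 <= l)%N -> row4 s t s' t' 0 l = r0 0 l) ->
  chain_dom r0 k (1%:M, row4 s t s' t').
Proof.
move=> okl okr tt' ttd rr; have [e0 e1 e2 e3] := row4E s t s' t'.
split=> //; first exact: pinned1.
by apply/fn_discP; rewrite /= e0 e1 e2 e3; split=> //; exact: unitmx1.
Qed.

Lemma fn_mul_det01 t s : fn_ok mu nu t s -> \det (fn mu nu t s 0 *m fn mu nu t s 1) = del.
Proof.
move=> ok; have [td _] := fn_local_system mu0 nu0 prod1 ok.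
by rewrite det_mulmx (td 0).2 (td 1).2.
Qed.

Lemma fn_mul_det12 t s : fn_ok mu nu t s ->
  \det (fn mu nu t s 1 *m fn mu nu t s i2) = (mu 1 * nu 1) * (mu i2 * nu i2).
Proof.
move=> ok; have [td _] := fn_local_system mu0 nu0 prod1 ok.
by rewrite det_mulmx (td 1).2 (td i2).2.
Qed.

Lemma fn_mul_trace01 t s : fn_ok mu nu t s ->
  \tr (fn mu nu t s 0 *m fn mu nu t s 1) = t + del / t.
Proof. by move=> ok; rewrite fn_mul01// mx2_trace !mx22E. Qed.

Lemma chain_step_slice (r0 : 'rV[K]_4) k : chain_dom r0 0 (1%:M, r0) -> (k < 14)%N ->
  exists2 h, @regular K V h &
    (forall v, (fn_family mu nu @` chain_dom r0 k) v -> h v = 0) /\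
    exists2 v, (fn_family mu nu @` chain_dom r0 k.+1) v & h v <> 0.
Proof.
move=> [_ _ d0] ltk; have [_ okl okr [tt' ttd]] := (fn_discP _ _ _).1 d0.
have ltk' : (k < size slice)%N by rewrite size_slice.
pose P : 'M[K]_4 := 1%:M + delta_mx (nth (0, 0) slice k).1 (nth (0, 0) slice k).2.
have uP : P \in unitmx by exact: unitmx_add_delta.
pose M0 := block_quadruple (fn_left mu nu r0) (fn_right mu nu r0).
have s00 : (0, 0) \notin slice by rewrite mem_slice inE eqxx.
have [||h [rh hw h0]] := @orbit_separator K 3 V 'I_4 (fun v j => v j) M0 slice
  (@regular_entry K) _ s00 (fun p C => fn_pinned_centralizer mu0 nu0 okl okr tt' ttd (C := C))
  k (fn_family mu nu (P, r0)) ltk'.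
- by rewrite filter_uniq// enum_uniq.
- by move=> j; rewrite ffunE /= !mulmxA mulmxV// mul1mx.
exists h => //; split; last first.
  exists (fn_family mu nu (P, r0)); last exact/eqP.
  exists (P, r0) => //; split=> //; first exact: pinned_add_delta.
  by apply/fn_discP.
move=> _ [x [px xr dx] <-]; have [ux _ _ _] := (fn_discP _ _ _).1 dx.
(* Truncated subtraction makes [k - 14] zero here, so all four coordinates are still fixed. *)
have xr0 : x.2 = r0.
  apply/rowP => l; apply: xr; rewrite (eqP (_ : k - 14 == 0)%N)// subn_eq0.
  exact: ltnW.
apply: (h0 _ x.1) => //.
  by apply: contraTneq ux => ->; rewrite unitmxE det0 unitr0.
by move=> j; rewrite ffunE xr0 !mulmxA mulmxV// mul1mx.
Qed.

Lemma chain_step_moduli t t' t1 t1' k (r0 := row4 1 t 1 t') :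
  fn_ok mu nu t 1 -> fn_ok mu nu t' 1 -> fn_ok mu nu t1 1 -> fn_ok mu nu t1' 1 ->
  fn_entry mu nu t != 0 -> fn_entry mu nu t' != 0 ->
  t != t' -> t * t' != del -> t1 != t' -> t1 * t' != del -> t1 != t -> t1 * t != del ->
  t != t1' -> t * t1' != del -> t1' != t' -> t1' * t' != del ->
  (14 <= k < 18)%N ->
  exists2 h, @regular K V h &
    (forall v, (fn_family mu nu @` chain_dom r0 k) v -> h v = 0) /\
    exists2 v, (fn_family mu nu @` chain_dom r0 k.+1) v & h v <> 0.
Proof.
move=> ok ok' ok1 ok1' e0 e0' tt' ttd t1t' t1t'd t1t t1td tt1' tt1'd t1't' t1't'd kk.
have [t0 _ _ _ _] := fn_okP mu0 nu0 ok; have [t0' _ _ _ _] := fn_okP mu0 nu0 ok'.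
have [t10 _ _ _ _] := fn_okP mu0 nu0 ok1; have [t10' _ _ _ _] := fn_okP mu0 nu0 ok1'.
have [r00 r01 r02 r03] := row4E 1 t 1 t'.
have okx j x : chain_dom r0 j x -> [/\ x.1 \in unitmx, fn_ok mu nu (x.2 0 1) (x.2 0 0)
    & fn_ok mu nu (x.2 0 i3) (x.2 0 i2)].
  by case=> _ _ /fn_discP[].
pose tr2 s u := \tr (fn mu nu u s 1 *m fn mu nu u s i2).
have : k \in iota 14 4 by rewrite mem_iota.
rewrite !inE => /or4P[]/eqP->{k kk}.
(* All coordinates are fixed, so the trace of [v 1 *m v i2] is constant; a new twist of the first
   block changes it. *)
- pose c := tr2 1 t + tr2 1 t'.
  have [s oks trs] := fn_twist mu0 nu0 (tr2 1 t) ok e0.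
  exists (fun v : V => \tr (v 1 *m v i2) - c); first exact: regular_trace2.
  split=> [_ [x Wx <-]|].
    have [ux _ _] := okx _ _ Wx; case: Wx => _ xr _.
    rewrite fn_family_trace// /fn_left /fn_right !xr// /r0 r00 r01 r02 r03.
    exact: subrr.
  exists (fn_family mu nu (1%:M, row4 s t 1 t')).
    exists (1%:M, row4 s t 1 t') => //; apply: chain_dom_row4 => //.
    by apply: ord4P => //; rewrite /r0 !mxE.
  rewrite fn_family_trace ?unitmx1// /fn_left /fn_right.
  have [-> -> -> ->] := row4E s t 1 t'.
  apply/eqP; rewrite subr_eq0 (inj_eq (addIr _)); exact: trs.
(* The twist now moves, but the trace of [v 0 *m v 1] depends only on the eigenvalues. *)
- pose c := t + del / t + (t' + del / t').
  exists (fun v : V => \tr (v 0 *m v 1) - c); first exact: regular_trace2.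
  split=> [_ [x Wx <-]|].
    have [ux okl okr] := okx _ _ Wx; case: Wx => _ xr _.
    rewrite fn_family_trace// /fn_left /fn_right !fn_mul_trace01//.
    by rewrite !xr// /r0 r01 r03 subrr.
  exists (fn_family mu nu (1%:M, row4 1 t1 1 t')).
    exists (1%:M, row4 1 t1 1 t') => //; apply: chain_dom_row4 => //.
    by apply: ord4P => //; rewrite /r0 !mxE.
  rewrite fn_family_trace ?unitmx1// /fn_left /fn_right.
  have [-> -> -> ->] := row4E 1 t1 1 t'.
  rewrite !fn_mul_trace01//; apply/eqP; rewrite subr_eq0 (inj_eq (addIr _)).
  exact: add_div_neq.
(* The first block moves freely, so sums of traces no longer isolate the second. The trace form
   vanishes once one block has trace [c]; the witness must move both blocks off [c], whence two
   twists. *)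
- pose c := tr2 1 t'; pose e := (mu 1 * nu 1) * (mu i2 * nu i2).
  have e_neq0 : e != 0 by rewrite !mulf_neq0.
  have [s oks trs] := fn_twist mu0 nu0 c ok e0.
  have [s' oks' trs'] := fn_twist mu0 nu0 c ok' e0'.
  exists (fun v : V => trace_form c e (v 1 *m v i2)); first exact: regular_trace_form.
  split=> [_ [x Wx <-]|].
    have [ux okl okr] := okx _ _ Wx; case: Wx => _ xr _.
    rewrite fn_family_trace_form ?fn_mul_det12// /fn_right !xr// /r0 r02 r03.
    by rewrite subrr expr0n mul0r mulr0.
  exists (fn_family mu nu (1%:M, row4 s t s' t')).
    exists (1%:M, row4 s t s' t') => //; apply: chain_dom_row4 => //.
    by apply: ord4P => //; rewrite /r0 !mxE.
  have [r0s r1s r2s r3s] := row4E s t s' t'.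
  rewrite fn_family_trace_form ?unitmx1 /fn_left /fn_right /= ?r0s ?r1s ?r2s ?r3s ?fn_mul_det12//.
  by apply/eqP; rewrite !mulf_neq0 ?expf_neq0 ?subr_eq0.
(* The same form for [v 0 *m v 1], which ignores the free twist of the second block; neither [t] nor
   [t1'] yields the trace [c]. *)
- pose c := t' + del / t'.
  have del0 : del != 0 by rewrite !mulf_neq0.
  exists (fun v : V => trace_form c del (v 0 *m v 1)); first exact: regular_trace_form.
  split=> [_ [x Wx <-]|].
    have [ux okl okr] := okx _ _ Wx; case: Wx => _ xr _.
    rewrite fn_family_trace_form ?fn_mul_det01// /fn_left /fn_right !fn_mul_trace01//.
    by rewrite [x.2 0 i3]xr// /r0 r03 subrr expr0n mul0r mulr0.
  exists (fn_family mu nu (1%:M, row4 1 t 1 t1')).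
    exists (1%:M, row4 1 t 1 t1') => //; apply: chain_dom_row4 => //.
    by apply: ord4P => //; rewrite /r0 !mxE.
  have [r0s r1s r2s r3s] := row4E 1 t 1 t1'.
  rewrite fn_family_trace_form ?unitmx1 /fn_left /fn_right /= ?r0s ?r1s ?r2s ?r3s ?fn_mul_det01//.
  rewrite !fn_mul_trace01//.
  by apply/eqP; rewrite !mulf_neq0 ?expf_neq0 ?subr_eq0 ?add_div_neq.
Qed.

Lemma zchain_varN : exists Z, zchain (varN mu nu) 18 Z.
Proof.
have [t [ok e0 _]] := fn_good mu0 nu0 [::].
(* [t] and [del / t] give the same trace of the first product, so each further eigenvalue has to
   avoid both. *)
have [t' [ok' e0' nt']] := fn_good mu0 nu0 [:: t; del / t].
have [t0 _ _ _ _] := fn_okP mu0 nu0 ok; have [t0' _ _ _ _] := fn_okP mu0 nu0 ok'.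
have [t't t'td] := notin_pair t0 nt'.
have tt' : t != t' by rewrite eq_sym.
have ttd : t * t' != del by rewrite mulrC.
have [t1 [ok1 _ nt1]] := fn_good mu0 nu0 ([:: t; del / t] ++ [:: t'; del / t']).
have [t1' [ok1' _ nt1']] := fn_good mu0 nu0 ([:: t; del / t] ++ [:: t'; del / t']).
have split_notin z : z \notin [:: t; del / t] ++ [:: t'; del / t'] ->
    z \notin [:: t; del / t] /\ z \notin [:: t'; del / t'].
  by rewrite mem_cat => /norP.
have [/(notin_pair t0)[t1t t1td] /(notin_pair t0')[t1t' t1t'd]] := split_notin _ nt1.
have [/(notin_pair t0)[t1't t1'td] /(notin_pair t0')[t1't' t1't'd]] := split_notin _ nt1'.
pose r0 := row4 1 t 1 t'.
have base k : chain_dom r0 k (1%:M, r0) by apply: chain_dom_row4.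
apply: (zchain_of_images (Y := fun k => fn_family mu nu @` chain_dom r0 k)) => k ltk.
  split; first by move=> _ [x [_ _ dx] <-]; exact: fn_family_varN.
    by exists (fn_family mu nu (1%:M, r0)); exists (1%:M, r0).
  exact: chain_dom_integral.
split; first by move=> _ [x Wx <-]; exists x => //; exact: chain_dom_sub.
have [lt14|ge14] := ltnP k 14; first exact: chain_step_slice.
apply: (chain_step_moduli (t1 := t1) (t1' := t1')) => //.
- by rewrite eq_sym.
- by rewrite mulrC.
- by rewrite ge14.
Qed.

Lemma has_dim_varN : has_dim (varN mu nu) 18.
Proof.
split; first exact: zchain_varN.
by move=> e Z chZ; exact: zchain_growth chZ (growth_varN mu0 nu0).
Qed.

End ChainInVarN.

Theorem mainTheorem15 (R : realType) (mu nu : 'I_4 -> R[i])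
    (hneq : forall j, mu j <> nu j)
    (hmu : forall j, mu j <> 0) (hnu : forall j, nu j <> 0)
    (hprod : \prod_(j < 4) (mu j * nu j) = 1)
    (hgen : forall sigma : 'I_4 -> R[i],
        (forall j, sigma j = mu j \/ sigma j = nu j) ->
        \prod_(j < 4) sigma j <> 1) :
  has_dim (varN mu nu) 18 /\
  exists d : 'I_4 -> nat,
    (forall j, has_dim (conj_class (mu j) (nu j)) (d j)) /\
    \sum_(j < 4) (d j)%:Z - 4 ^+ 2 + 1 = 17.
Proof.
have munu j : mu j != nu j by apply/eqP.
have mu0 j : mu j != 0 by apply/eqP.
have nu0 j : nu j != 0 by apply/eqP.
split; first exact: has_dim_varN.
exists (fun=> 8%N); split=> [j|]; first exact: has_dim_conj_class.
by rewrite sumr_const card_ord.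
Qed.
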